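(* Let $m,n\ge 2$ be integers, $\mathbb{K}$ a field, $S=\mathbb{K}[x_{i,j}: i\in[m], j\in[n]]$, $\tau$ the lexicographic order on $S$ induced by $x_{1,1}>x_{1,2}>\cdots>x_{1,n}>x_{2,1}>\cdots>x_{m,n}$ (row by row), and $\mathcal{J}_{K_m,P_n}\subseteq S$ the ideal generated by $x_{i,k}x_{j,k+1}-x_{i,k+1}x_{j,k}$ for $1\le i<j\le m$, $k\in[n-1]$. Then for all $t\ge 1$, \[\operatorname{reg}\left(S/\mathcal{J}_{K_m,P_n}^t\right)=\operatorname{reg}\left(S/\operatorname{in}_\tau(\mathcal{J}_{K_m,P_n}^t)\right)=2(t-1)+(n-1).\]
   Context: $\operatorname{reg}$ denotes Castelnuovo–Mumford regularity; $\operatorname{in}_\tau$ denotes the initial ideal with respect to $\tau$. *)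

(* Defs.v *)
From HB Require Import structures.
From mathcomp Require Import all_boot all_order all_algebra.
From mathcomp Require Import mpoly.
Set Implicit Arguments. Unset Strict Implicit. Unset Printing Implicit Defensive.
Import Order.TTheory GRing.Theory.
Local Open Scope ring_scope.

Section Defs.
Variables (K : fieldType) (N : nat).
Local Notation S := {mpoly K[N]}.

Definition ideal_gen (G : S -> Prop) (p : S) : Prop :=
  exists (cs gs : seq S), size cs = size gs /\ (forall g, g \in gs -> G g) /\
    p = \sum_(k < size gs) cs`_k * gs`_k.

Definition ideal_pow (I : S -> Prop) (t : nat) : S -> Prop :=
  ideal_gen (fun p => exists s : seq S,
     size s = t /\ (forall q, q \in s -> I q) /\ p = \prod_(q <- s) q).

Definition lex_le (m1 m2 : 'X_{1..N}) : Prop :=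
  m1 = m2 \/ exists k : 'I_N, (forall l : 'I_N, (l < k)%N -> m1 l = m2 l) /\
                              (m1 k < m2 k)%N.

Definition lead_mon_lex (p : S) (m : 'X_{1..N}) : Prop :=
  m \in msupp p /\ forall m', m' \in msupp p -> lex_le m' m.

Definition init_ideal (I : S -> Prop) : S -> Prop :=
  ideal_gen (fun q => exists p m, I p /\ lead_mon_lex p m /\ q = 'X_[m]).

Definition homog_deg (d : nat) (p : S) : Prop :=
  forall m, m \in msupp p -> mdeg m = d.

(* Koszul complex K(x_0,...,x_{N-1}; S/I).  A chain in homological degree i is
   a family z : {set 'I_N} -> S, supported on i-subsets A (basis e_A),
   representing an element of (+)_{|A|=i} (S/I) e_A.  The differential is
   d(e_A) = sum_{k in A} (-1)^{#{l in A | l < k}} x_k e_{A \ k}, i.e.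
   (d z)(B) = sum_{k notin B} (-1)^{#{l in B | l < k}} x_k z(B :|: {k}). *)
Definition kdiff (z : {set 'I_N} -> S) (B : {set 'I_N}) : S :=
  \sum_(k : 'I_N | k \notin B)
     (-1) ^+ #|[set l in B | (l < k)%N]| * 'X_k * z (k |: B).

(* A homogeneous chain of homological degree i and internal degree j:
   e_A has degree 1 each, so coefficients have degree j - i (when j < i the chain space is zero). *)
Definition kchain (i j : nat) (z : {set 'I_N} -> S) : Prop :=
  forall A : {set 'I_N},
    ((#|A| == i) && (i <= j)%N -> homog_deg (j - i) (z A)) /\
    (~~ ((#|A| == i) && (i <= j)%N) -> z A = 0).

(* H_i(x; S/I)_j <> 0, i.e. Tor_i^S(S/I, K)_j <> 0, i.e. beta_{i,j}(S/I) <> 0. *)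
Definition koszul_nonzero (I : S -> Prop) (i j : nat) : Prop :=
  (i <= j)%N /\
  exists z, kchain i j z /\
    (forall B : {set 'I_N}, #|B| = i.-1 -> (0 < i)%N -> I (kdiff z B)) /\
    ~ (exists w, kchain i.+1 j w /\ forall A : {set 'I_N}, #|A| = i -> I (z A - kdiff w A)).

Definition is_reg_quot (I : S -> Prop) (r : nat) : Prop :=
  (exists i j, koszul_nonzero I i j /\ (j - i)%N = r) /\
  (forall i j, koszul_nonzero I i j -> ((j - i) <= r)%N).

End Defs.

(* Variables x_{i,j} of K[x_{i,j} : i < m, j < n], indexed row by row:
   x_{i,j} |-> index i*n + j, so index order = x_{1,1},x_{1,2},...,x_{m,n}. *)
Lemma var_idx_lt (m n : nat) (i : 'I_m) (j : 'I_n) : (i * n + j < m * n)%N.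
Proof.
have hi := ltn_ord i; have hj := ltn_ord j.
apply: (@leq_trans (i * n + n)); first by rewrite ltn_add2l.
by rewrite -[X in (_ + X)%N]mul1n -mulnDl addn1 leq_mul2r hi orbT.
Qed.

Definition var_idx (m n : nat) (i : 'I_m) (j : 'I_n) : 'I_(m * n) :=
  Ordinal (var_idx_lt i j).

Definition xv (K : fieldType) (m n : nat) (i : 'I_m) (j : 'I_n) : {mpoly K[m * n]} :=
  'X_(var_idx i j).

Definition JKP_gens (K : fieldType) (m n : nat) (p : {mpoly K[m * n]}) : Prop :=
  exists (i j : 'I_m) (k l : 'I_n), (i < j)%N /\ val l = (val k).+1 /\
    p = xv K i k * xv K j l - xv K i l * xv K j k.

Definition JKP (K : fieldType) (m n : nat) : {mpoly K[m * n]} -> Prop :=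
  ideal_gen (@JKP_gens K m n).

Arguments JKP K m n : clear implicits.
Arguments JKP_gens K m n : clear implicits.

(* Main.v *)
(** Let f run over the generating 2-minors of J; their leading terms
    x_{i,k} x_{j,k+1}, i < j, are the edges of a bipartite graph.

    Every induced subgraph with an edge has an edge xy such that each neighbour of x
    is adjacent to each neighbour of y: take the first column containing the left end
    of an edge, y in the largest row of the next column, and x in the largest row above y.
    A factorization of a monomial into t edges times a monomial can be moved to one using
    xy by elementary exchanges, and these lift to Pluecker-type relations between the
    minors with smaller remaining terms.  Hence in(J^t) = in(J)^t, and moreover
    in(J)^(t+1) : xy = in(J)^t.

    The sequence 0 -> S/(I : v) -> S/I -> S/(I, v) -> 0 for a variable v then bounds the
    regularity of S/in(J)^t: split off y, then its neighbours one after the other; either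
    an edge is divided out and t drops, or y becomes isolated and a pair of columns is used
    up.  Filtering the Koszul complex by leading multidegrees carries the bound over to J^t.

    For the lower bound, send x_{1,k} and x_{2,k+1} to y_k and all other variables to 0.
    In n - 1 variables the top Koszul homology is a socle, and explicit Koszul cycles for
    J^t and in(J)^t are sent to +-y_1^(2t-1) y_2 ... y_(n-1).  This is not in
    (y_k^2 - y_{k-1} y_{k+1} : k)^t because the products of powers of these quadrics with
    squarefree monomials form a basis of the polynomial ring. *)

From HB Require Import structures.
From mathcomp Require Import all_boot all_order all_algebra.
From mathcomp Require Import mpoly.
From mathcomp Require Import zify ring.
Require Import Defs.

Set Implicit Arguments. Unset Strict Implicit. Unset Printing Implicit Defensive.
Import Order.TTheory GRing.Theory.
Local Open Scope ring_scope.

(** * The Koszul complex in a fixed multidegree *)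

Section WeightedKoszul.
Variables (R : comNzRingType) (N : nat) (x : 'I_N -> R).
Implicit Types (z : {set 'I_N} -> R) (A B : {set 'I_N}) (k l : 'I_N).

Definition pos B k := #|[set l in B | (l < k)%N]|.

(** The weights stay free because four choices occur: 1 on a multidegree strand, the variables
    (giving [kdiff]), their images [spec_var], and the first-row variables [above] that build a
    cycle. *)
Definition gdiff z B : R :=
  \sum_(k : 'I_N | k \notin B) (-1) ^+ pos B k * x k * z (k |: B).

Lemma posE B k : pos B k = (\sum_(l in B) (l < k)%N)%N.
Proof.
rewrite /pos -sum1dep_card big_mkcondr /=.
by apply: eq_bigr => l _; case: (l < k)%N.
Qed.

Lemma posU1 B k l : k \notin B -> pos (k |: B) l = ((k < l)%N + pos B l)%N.
Proof. by move=> kB; rewrite !posE big_setU1. Qed.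

Lemma sum_pairs_in (I : R -> Prop) (F : 'I_N -> 'I_N -> R) (P : pred 'I_N) :
  I 0 -> (forall p q, I p -> I q -> I (p + q)) ->
  (forall k l, P k -> P l -> k != l -> I (F k l + F l k)) ->
  I (\sum_(k | P k) \sum_(l | P l && (l != k)) F k l).
Proof.
move=> I0 ID FI; rewrite pair_big_dep /=.
rewrite (bigID (fun p : 'I_N * 'I_N => (p.1 < p.2)%N)) /=.
rewrite [X in _ + X](reindex_inj (h := fun p => (p.2, p.1))) /=; last first.
  by move=> [a b] [c d] [-> ->].
rewrite [X in _ + X](_ : _ = \sum_(p : 'I_N * 'I_N |
   P p.1 && (P p.2 && (p.2 != p.1)) && (p.1 < p.2)%N) F p.2 p.1); last first.
  apply: eq_bigl => -[a b] /=; case: (P a); case: (P b) => //=.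
  by rewrite -!val_eqE /=; case: ltngtP.
rewrite -big_split /=; apply: big_ind => // -[a b] /=.
by move=> /andP[/andP[Pa /andP[Pb ba]] _]; apply: FI; rewrite // eq_sym.
Qed.

End WeightedKoszul.

Section TwoWeights.
Variables (R : comNzRingType) (N : nat).
Implicit Types (x y : 'I_N -> R) (z : {set 'I_N} -> R) (B : {set 'I_N}).

(** Inserting k and l in the two possible orders gives opposite Koszul signs, so the composite
    leaves only the 2-minors of the matrix with rows [x] and [y]. Equal weights give d^2 = 0;
    unequal ones produce minors for [minor_cycle_cycle]. *)
Lemma gdiff2_in (I : R -> Prop) x y z B :
  I 0 -> (forall p q, I p -> I q -> I (p + q)) ->
  (forall k l, k \notin B -> l \notin B -> k != l ->
     forall s, I ((-1) ^+ s * (x k * y l - x l * y k) * z (k |: (l |: B)))) ->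
  I (gdiff x (gdiff y z) B).
Proof.
move=> I0 ID H.
pose F (k l : 'I_N) := (-1) ^+ (pos B k + (k < l)%N + pos B l) * (x k * y l) * z (l |: (k |: B)).
have -> : gdiff x (gdiff y z) B =
    \sum_(k | k \notin B) \sum_(l | (l \notin B) && (l != k)) F k l.
  apply: eq_bigr => k kB; rewrite mulr_sumr; apply: eq_big => l.
    by rewrite !inE negb_or andbC.
  rewrite !inE negb_or => /andP[lk lB].
  by rewrite posU1 // /F !exprD; ring.
apply: sum_pairs_in => // k l kB lB kl.
have := H k l kB lB kl (pos B k + (k < l)%N + pos B l)%N; congr I.
rewrite /F (setUCA [set l]) !exprD; have [h|h|/ord_inj h] := ltngtP k l.
- by rewrite /= expr0 expr1; ring.
- by rewrite /= expr0 expr1; ring.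
- by rewrite h eqxx in kl.
Qed.

End TwoWeights.

Section WeightedKoszulTheory.
Variables (R : comNzRingType) (N : nat) (x : 'I_N -> R).
Implicit Types (z : {set 'I_N} -> R) (A B : {set 'I_N}) (k l : 'I_N).

Lemma gdiff_gdiff z B : gdiff x (gdiff x z) B = 0.
Proof.
apply: (@gdiff2_in _ _ (fun p => p = 0)) => // [p q -> ->|k l _ _ _ s].
  by rewrite addr0.
by rewrite (mulrC (x l)) subrr mulr0 mul0r.
Qed.

Lemma gdiffD z1 z2 B : gdiff x (fun A => z1 A + z2 A) B = gdiff x z1 B + gdiff x z2 B.
Proof. by rewrite -big_split; apply: eq_bigr => k _; rewrite mulrDr. Qed.

Lemma gdiffN z B : gdiff x (fun A => - z A) B = - gdiff x z B.
Proof. by rewrite -sumrN; apply: eq_bigr => k _; rewrite mulrN. Qed.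

Lemma gdiffB z1 z2 B : gdiff x (fun A => z1 A - z2 A) B = gdiff x z1 B - gdiff x z2 B.
Proof. by rewrite gdiffD gdiffN. Qed.

Lemma eq_gdiff z1 z2 B :
  (forall k, k \notin B -> z1 (k |: B) = z2 (k |: B)) -> gdiff x z1 B = gdiff x z2 B.
Proof. by move=> h; apply: eq_bigr => k kB; rewrite h. Qed.

Lemma gdiff0 z B : (forall k, k \notin B -> z (k |: B) = 0) -> gdiff x z B = 0.
Proof. by move=> h; rewrite /gdiff big1 // => k kB; rewrite h ?mulr0. Qed.

(** Wedging with e_v is a contracting homotopy h when [v] has weight 1: this is d h = id - h d, read
    at [A]. *)
Lemma gdiff_cone z v A : x v = 1 ->
  gdiff x (fun D : {set _} => if v \in D then (-1) ^+ pos (D :\ v) v * z (D :\ v) else 0) A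
  = z A - (if v \in A then (-1) ^+ pos (A :\ v) v * gdiff x z (A :\ v) else 0).
Proof.
move=> xv; case: ifP => vA; last first.
  rewrite /gdiff (bigD1 v) ?vA //= big1 => [|k /andP[kA kv]].
    rewrite !inE eqxx /= addr0 subr0 setU1K ?vA //.
    by rewrite xv mulr1 signrMK.
  by rewrite !inE eq_sym (negbTE kv) vA mulr0.
have vAv : v \notin A :\ v by rewrite !inE eqxx.
rewrite /gdiff [in RHS](bigD1 v) //= setD1K // mulrDr.
rewrite xv mulr1 signrMK.
rewrite opprD addrA subrr sub0r mulr_sumr -sumrN.
apply: eq_big => [k|k kA]; first by rewrite !inE; case: eqP => [->|] //=; rewrite ?vA ?andbT.
have kv : k != v by apply: contraNneq kA => ->.
have e : (k |: A) :\ v = k |: (A :\ v).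
  by apply/setP => j; rewrite !inE; case: (j =P k) => [->|] //=; rewrite kv.
have kAv : k \notin A :\ v by rewrite !inE negb_and kA orbT.
rewrite !inE vA orbT e posU1 // -{1}(setD1K vA) posU1 // !exprD.
have [h|h|/ord_inj h] := ltngtP k v; last by rewrite h eqxx in kv.
  by rewrite /= expr0 expr1; ring.
by rewrite /= expr0 expr1; ring.
Qed.

End WeightedKoszulTheory.

(** * Exactness of multidegree strands for monomial ideals *)

Section MonomialExactness.
Variables (K : fieldType) (N : nat).
Implicit Types (c w : {set 'I_N} -> K) (A B : {set 'I_N}) (u m : 'X_{1..N})
  (G : pred 'X_{1..N}).

Definition ind A : 'X_{1..N} := [multinom (i \in A : nat) | i < N].

Lemma indE A i : ind A i = (i \in A).
Proof. exact: mnmE. Qed.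

Lemma indU1 A k : k \notin A -> ind (k |: A) = (U_(k) + ind A)%MM.
Proof.
move=> kA; apply/mnmP => i; rewrite mnmDE !indE mnm1E !inE (eq_sym k).
by case: eqP => [->|]; rewrite ?(negbTE kA).
Qed.

Lemma mdeg_ind A : mdeg (ind A) = #|A|.
Proof.
rewrite mdegE -sum1_card [RHS]big_mkcond /=; apply: eq_bigr => i _.
by rewrite indE; case: (i \in A).
Qed.

Definition cdiff c B : K := gdiff (fun=> 1) c B.

Definition below u c := forall A, ~~ (ind A <= u)%MM -> c A = 0.

(* Exactness in homological degree [i] of the multidegree-[u] strand of the
   Koszul complex of S/(G): a basis element e_A carries the monomial x^(u - A),
   so it survives iff A <= u and u - A is not in G. *)
Definition exact G i u := forall c, below u c ->
  (forall B, #|B|.+1 = i -> (ind B <= u)%MM -> ~~ G (u - ind B)%MM -> cdiff c B = 0) ->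
  exists2 w, below u w &
    forall A, #|A| = i -> (ind A <= u)%MM -> ~~ G (u - ind A)%MM -> c A = cdiff w A.

Definition upclosed G := forall m m', (m <= m')%MM -> G m -> G m'.

Lemma eq_exact G1 G2 i u : G1 =1 G2 -> exact G1 i u -> exact G2 i u.
Proof.
move=> e ex c bc cyc; have [|w bw hw] := ex c bc.
  by move=> B ? ?; rewrite e; apply: cyc.
by exists w => // A ? ?; rewrite -e; apply: hw.
Qed.

Lemma exact_all i u G : (forall m, G m) -> exact G i u.
Proof. by move=> h c bc _; exists (fun=> 0) => // A _ _; rewrite h. Qed.

Definition colon v G := fun m => G (m + U_(v))%MM.
Definition addvar v G := fun m : 'X_{1..N} => G m || (0 < m v)%N.

Lemma ind_leU1 A k u : (ind (k |: A) <= u)%MM -> (ind A <= u)%MM.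
Proof.
move/mnm_lepP => h; apply/mnm_lepP => i; apply: leq_trans (h i).
by rewrite !indE !inE; case: (i \in A); rewrite ?orbT.
Qed.

(* The middle term of 0 -> S/(G : v) -> S/G -> S/(G, v) -> 0. *)
Lemma exact_mid G v i u : upclosed G ->
  ((0 < u v)%N -> exact (colon v G) i (u - U_(v))%MM) ->
  exact (addvar v G) i u -> exact G i u.
Proof.
move=> up exC exA c bc cyc.
have [|w bw hw] := exA c bc.
  by move=> B cB Bu; rewrite negb_or => /andP[nG _]; apply: cyc.
have [uv0|uv] := posnP (u v).
  exists w => // A cA Au nG; apply: hw => //.
  by rewrite negb_or nG mnmBE uv0.
pose u' := (u - U_(v))%MM.
have leU : (U_(v) <= u)%MM by rewrite lep1mP -lt0n.
have lt' A : (ind A <= u')%MM = (ind A <= u)%MM && (0 < u v - ind A v)%N.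
  apply/mnm_lepP/andP => [h|[/mnm_lepP h1 h2] j].
    split; first by apply/mnm_lepP => j; apply: leq_trans (h j) _; rewrite mnmBE leq_subr.
    by have := h v; rewrite mnmBE mnm1E eqxx; lia.
  rewrite mnmBE mnm1E; have := h1 j; case: eqP => [<-|_]; lia.
have upU k B : k \notin B -> ~~ G (u - ind B)%MM -> ~~ G (u - ind (k |: B))%MM.
  move=> kB; apply: contra; apply: up; apply/mnm_lepP => j; rewrite !mnmBE.
  by apply: leq_sub2l; rewrite !indE !inE; case: (j \in B); rewrite ?orbT.
(* Modulo [G], the corrected cycle survives only where [x_v] still divides the coefficient; dividing
   by [x_v] makes it a cycle for the colon ideal in multidegree [u - U_(v)]. *)
pose c1 A := if (ind A <= u')%MM then c A - cdiff w A else 0.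
have cdw A : ~~ (ind A <= u)%MM -> cdiff w A = 0.
  move=> nA; rewrite /cdiff gdiff0 // => k kA; apply: bw.
  by apply: contra nA; apply: ind_leU1.
have eqc A : (ind A <= u')%MM -> (u' - ind A + U_(v))%MM = (u - ind A)%MM.
  rewrite lt' => /andP[_ h]; apply/mnmP => j; rewrite mnmDE !mnmBE mnm1E.
  by case: eqP => [<-|_]; lia.
have [|B cB Bu nG|w' bw' hw'] := exC uv c1.
- by move=> A nA; rewrite /c1 (negbTE nA).
- have nGB : ~~ G (u - ind B)%MM by move: nG; rewrite /colon eqc.
  move: (Bu); rewrite lt' => /andP[Bu' ci_basis].
  rewrite /cdiff (@eq_gdiff _ _ _ _ (fun A => c A - cdiff w A)) => [|k kB].
    by rewrite gdiffB gdiff_gdiff subr0; apply: cyc.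
  rewrite /c1 lt'; case: (boolP (ind (k |: B) <= u)%MM) => /= kBu; last first.
    by rewrite bc // cdw // subr0.
  case: posnP => // h; rewrite hw ?subrr //; first by rewrite cardsU1 kB.
  by rewrite negb_or upU // mnmBE h.
- exists (fun A => w A + w' A) => [A nA|A cA Au nG].
    by rewrite bw // bw' ?addr0 // lt' (negbTE nA).
  rewrite {1}/cdiff gdiffD; case: (posnP (u v - ind A v)) => h.
    have -> : gdiff (fun=> 1) w' A = 0.
      apply: gdiff0 => k kA; apply: bw'; rewrite lt' negb_and -eqn0Ngt; apply/orP; right.
      rewrite -leqn0 -[X in (_ <= X)%N]h; apply: leq_sub2l.
      by rewrite !indE !inE; case: (v \in A); rewrite ?orbT.
    by rewrite addr0; apply: hw => //; rewrite negb_or nG mnmBE h.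
  have Au' : (ind A <= u')%MM by rewrite lt' Au.
  have := hw' A cA Au'; rewrite /colon eqc // => /(_ nG).
  by rewrite /c1 Au' => /eqP; rewrite subr_eq => /eqP ->; rewrite addrC.
Qed.

(** If a variable of [V] divides x^u, adding or removing it does not change which basis elements
    survive, so its cone contracts the strand. Otherwise a surviving e_A forces u <= A, hence
    [mdeg u <= i], which is excluded. *)
Lemma exact_vars (V : {set 'I_N}) i u : (i < mdeg u)%N ->
  exact (fun m => [exists v, (v \notin V) && (0 < m v)%N]) i u.
Proof.
move=> iu c bc cyc.
case: (boolP [exists v, (v \in V) && (0 < u v)%N]) => [/existsP[v /andP[vV uv]]|nV].
  have Dv B A : (A == B :\ v) || (B == A :\ v) ->
     [exists j, (j \notin V) && (0 < (u - ind A)%MM j)%N] =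
     [exists j, (j \notin V) && (0 < (u - ind B)%MM j)%N].
    move=> h; apply: eq_existsb => j; case: (boolP (j \in V)) => //= jV.
    have jv : j != v by apply: contraNneq jV => ->.
    rewrite !mnmBE !indE; case/orP: h => /eqP ->; by rewrite !inE jv.
  exists (fun D : {set _} => if v \in D then (-1) ^+ pos (D :\ v) v * c (D :\ v) else 0) =>
    [A nA|A cA Au nG].
    case: ifP => // vA; rewrite bc ?mulr0 //; apply: contra nA => /mnm_lepP h.
    apply/mnm_lepP => j; have := h j; rewrite !indE !inE.
    by case: eqP => [->|] //=; rewrite vA.
  rewrite /cdiff gdiff_cone //; case: ifP => vA; last by rewrite subr0.
  rewrite [X in _ * X](_ : _ = 0) ?mulr0 ?subr0 //; apply: cyc.
  - by rewrite -cA (cardsD1 v A) vA.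
  - by apply: (@ind_leU1 _ v); rewrite setD1K.
  - by rewrite (@Dv A) ?eqxx.
exists (fun=> 0) => // A cA /mnm_lepP Au nG; exfalso; move: iu.
rewrite -cA -mdeg_ind ltnNge => /negP; apply; rewrite !mdegE; apply: leq_sum => j _.
move: nV nG; rewrite !negb_exists => /forallP/(_ j) + /forallP/(_ j).
by rewrite !negb_and !negbK -!leqNgt mnmBE; case: (j \in V) => /=; lia.
Qed.

End MonomialExactness.

(** * Passing to leading terms *)

Section Transfer.
Variables (K : fieldType) (N : nat).
Local Notation S := {mpoly K[N]}.
Implicit Types (z : {set 'I_N} -> S) (A B : {set 'I_N}) (u m : 'X_{1..N}) (p : S).

Lemma homog_degE d p : homog_deg d p <-> p \is d.-homog.
Proof. by split => [h|/dhomogP //]; apply/dhomogP. Qed.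

Lemma mcoeffMXU p k m :
  (p * 'X_k)@_m = if (0 < m k)%N then p@_(m - U_(k))%MM else 0.
Proof.
case: posnP => mk; last first.
  by rewrite -[in LHS](@submK _ U_(k) m) ?lep1mP -?lt0n // addmC mcoeffMX.
apply/memN_msupp_eq0; rewrite (perm_mem (msuppMX _ _)).
by apply/mapP => -[m' _ e]; move: mk; rewrite e mnmDE mnm1E eqxx.
Qed.

Definition chain_coef z u A : K := if (ind A <= u)%MM then (z A)@_(u - ind A)%MM else 0.

Lemma chain_coef_below z u : below u (chain_coef z u).
Proof. by move=> A nA; rewrite /chain_coef (negbTE nA). Qed.

Lemma mcoeff_kdiff z B m : (kdiff z B)@_m = cdiff (chain_coef z (m + ind B)%MM) B.
Proof.
rewrite raddf_sum; apply: eq_bigr => k kB /=.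
rewrite -mulrA (mulrC 'X_k) mulr1 /chain_coef indU1 //.
have -> : (-1) ^+ pos B k = ((-1) ^+ pos B k)%:MP :> S.
  by rewrite rmorphXn /= mpolyCN.
rewrite mcoeffCM mcoeffMXU; congr (_ * _).
have -> : (U_(k) + ind B <= m + ind B)%MM = (0 < m k)%N.
  apply/mnm_lepP/idP => [/(_ k)|h i]; rewrite !mnmDE mnm1E ?eqxx; first lia.
  by case: eqP => [<-|] /=; lia.
case: ifP => // mk; congr (_@__); apply/mnmP => i; rewrite !mnmBE !mnmDE.
lia.
Qed.

Definition bounded_by u z := forall A m, m \in msupp (z A) -> ((m + ind A)%MM <= u)%O.

Lemma bounded_by_chain_coef u z u' A : bounded_by u z -> (u < u')%O -> chain_coef z u' A = 0.
Proof.
move=> bz lt; rewrite /chain_coef; case: ifP => // Au; apply/memN_msupp_eq0.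
by apply/negP => /bz; rewrite submK // leNgt lt.
Qed.

Lemma bounded_by_kdiff u z : bounded_by u z -> bounded_by u (kdiff z).
Proof.
move=> bz B m; rewrite mcoeff_msupp mcoeff_kdiff; apply: contraR.
rewrite -ltNge => lt; rewrite /cdiff gdiff0 // => k kB.
exact: bounded_by_chain_coef bz lt.
Qed.

Variables (I : S -> Prop) (G : pred 'X_{1..N}).
Hypothesis I0 : I 0.
Hypothesis ID : forall p q, I p -> I q -> I (p + q).
Hypothesis IM : forall p q, I q -> I (p * q).
(** With [lead_onto], this makes [G] the set of leading exponents of [I] for the graded
    lexicographic order; the homogeneous witnesses keep corrections in the same internal degree. *)
Hypothesis lead_in : forall p, I p -> p != 0 -> G (mlead p).
Hypothesis lead_onto : forall u, G u ->
  exists p, [/\ I p, p \is (mdeg u).-homog, p@_u = 1 & (mlead p <= u)%O].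

Lemma IZ c p : I p -> I (c *: p).
Proof. by rewrite -mul_mpolyC; apply: IM. Qed.

Lemma IN p : I p -> I (- p).
Proof. by rewrite -scaleN1r; apply: IZ. Qed.

Lemma IB p q : I p -> I q -> I (p - q).
Proof. by move=> Ip Iq; apply: ID => //; apply: IN. Qed.

Lemma I_kdiff z B : (forall k, k \notin B -> I (z (k |: B))) -> I (kdiff z B).
Proof.
by move=> h; rewrite /kdiff; apply: big_ind => // k kB; apply: IM; apply: h.
Qed.

Variables (i j : nat).
Hypothesis exG : forall u, mdeg u = j -> exact K G i u.

Definition cycle z := forall B, #|B| = i.-1 -> (0 < i)%N -> I (kdiff z B).
Definition boundary z :=
  exists w, kchain i.+1 j w /\ forall A, #|A| = i -> I (z A - kdiff w A).

(** A nonzero chain has a largest multidegree; it is a bound strictly below [u], to which the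
    induction hypothesis applies. *)
Lemma boundary_strict u z :
  (forall u', (u' < u)%O -> forall z, kchain i j z -> cycle z -> bounded_by u' z -> boundary z) ->
  kchain i j z -> cycle z ->
  (forall A m, m \in msupp (z A) -> ((m + ind A)%MM < u)%O) -> boundary z.
Proof.
move=> IH zc zcyc bz.
case: (boolP [exists A, z A != 0]) => [/existsP[A0 A0z]|/existsPn z0]; last first.
  exists (fun=> 0); split; first by move=> A; split=> // _ m; rewrite msupp0.
  move=> A _; move: (z0 A); rewrite negbK => /eqP ->.
  by rewrite /kdiff big1 ?subr0 // => k _; rewrite mulr0.
pose f (A : {set _}) := (mlead (z A) + ind A)%MM.
case: (@arg_maxP _ _ _ A0 (fun A => z A != 0) f A0z) => A1 A1z A1max.
apply: (IH (f A1)) => //; first by apply: bz; apply: mlead_supp.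
move=> A m mA; apply: (le_trans (y := f A)).
  by rewrite lemc_add2l msupp_le_mlead.
by apply: A1max; apply: contraTneq mA => ->; rewrite msupp0.
Qed.

(** The lift has coefficients [w D] x^(u - D), so its differential lives in multidegree [u] alone
    and disturbs no other strand. *)
Lemma lift_boundary u w : mdeg u = j ->
  exists W, [/\ kchain i.+1 j W, bounded_by u W &
    forall A m, (kdiff W A)@_m = if (#|A| == i) && ((m + ind A)%MM == u)
      then cdiff (fun D : {set _} => if (ind D <= u)%MM then w D else 0) A else 0].
Proof.
move=> du.
pose W (D : {set _}) : S := if (#|D| == i.+1) && (ind D <= u)%MM then w D *: 'X_[u - ind D]
  else 0.
have dD (D : {set _}) : (ind D <= u)%MM -> (mdeg (u - ind D) + #|D|)%N = j.
  by move=> h; rewrite -mdeg_ind -mdegD submK.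
exists W; split.
- move=> D; split=> [/andP[/eqP cD ij] m|].
    rewrite /W; case: ifP => [/andP[_ Du] |]; last by rewrite msupp0.
    by move/msuppZ_le; rewrite msuppX inE => /eqP ->; have := dD _ Du; lia.
  rewrite /W; case: ifP => // /andP[/eqP cD Du].
  by rewrite cD eqxx /=; have := dD _ Du; lia.
- move=> D m; rewrite /W; case: ifP => [/andP[_ Du]|]; last by rewrite msupp0.
  by move/msuppZ_le; rewrite msuppX inE => /eqP ->; rewrite submK.
move=> A m; rewrite mcoeff_kdiff.
case: ifP => [/andP[/eqP cA /eqP em]|h].
  apply: eq_gdiff => k kA; rewrite em /chain_coef /W cardsU1 kA cA eqxx /=.
  by case: ifP => // ->; rewrite mcoeffZ mcoeffX eqxx mulr1.
rewrite /cdiff gdiff0 // => k kA; rewrite /chain_coef; case: ifP => // Du.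
rewrite /W cardsU1 kA eqSS; case: ifP => [/andP[cA Du']|]; last by rewrite mcoeff0.
rewrite mcoeffZ mcoeffX; case: eqP => [e|]; last by rewrite mulr0.
by move: h; rewrite cA /= -(submK Du) -e submK // eqxx.
Qed.

(** Induction on a bound [u] for the multidegrees of the cycle. Its part of multidegree [u] is a
    cycle over S/(G), hence a boundary there by [exG]; after subtracting a lift and suitable
    elements of [I], only smaller multidegrees remain. *)
Lemma transfer z : (i <= j)%N -> kchain i j z -> cycle z -> boundary z.
Proof.
move=> ij zc zcyc.
suff main u : forall z, kchain i j z -> cycle z -> bounded_by u z -> boundary z.
  pose u := (\join_(A : {set 'I_N}) (mlead (z A) + ind A)%MM)%O.
  apply: (main u) => // A m mA; apply: (le_trans (y := (mlead (z A) + ind A)%MM)).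
    by rewrite lemc_add2l msupp_le_mlead.
  exact: (@joins_sup _ _ _ A xpredT (fun A : {set 'I_N} => (mlead (z A) + ind A)%MM)).
move: u => {z zc zcyc}; elim/(@ltmwf N) => u IH z zc zcyc bz.
(* All multidegrees of the chain have total degree j, so a bound [u] of another degree is not
   attained. *)
have [du|du] := eqVneq (mdeg u) j; last first.
  apply: (boundary_strict IH) => // A m mA; rewrite lt_neqAle bz // andbT.
  apply: contraNneq du => <-; case: (zc A) => hA hA0.
  case: (boolP ((#|A| == i) && (i <= j)%N)) => cA; last first.
    by move: mA; rewrite hA0 // msupp0.
  by rewrite mdegD mdeg_ind (hA cA _ mA); case/andP: cA => /eqP -> ?; rewrite subnK.
have [B cB Bu nG|w bw hw] := exG du (@chain_coef_below z u).
  have e : cdiff (chain_coef z u) B = (kdiff z B)@_(u - ind B).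
    by rewrite mcoeff_kdiff submK.
  (* A nonzero coefficient here would be the leading one of an element of [I], putting [u - ind B]
     into [G]. *)
  rewrite e; apply/eqP; apply: contraNT nG => nz.
  have nz0 : kdiff z B != 0 by apply: contraNneq nz => ->; rewrite mcoeff0.
  suff -> : (u - ind B)%MM = mlead (kdiff z B).
    by apply: lead_in => //; apply: zcyc; rewrite -?cB.
  apply/eqP; rewrite eq_le; apply/andP; split.
    by rewrite msupp_le_mlead // mcoeff_msupp.
  rewrite -(lemc_add2l _ _ (ind B)) submK //.
  by apply: (bounded_by_kdiff bz); apply: mlead_supp.
have [W [Wc bW cW]] := lift_boundary w du.
(* These basis elements vanish in the strand over S/(G); their coefficient is cancelled instead by
   an element of [I] with leading exponent [u - ind A]. *)
pose bad (A : {set _}) := [&& #|A| == i, (ind A <= u)%MM & G (u - ind A)%MM].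
have /fin_all_exists[q hq] : forall A, exists p : S, if bad A then
    [/\ I p, p \is (mdeg (u - ind A)).-homog, p@_(u - ind A) = 1
      & (mlead p <= (u - ind A)%MM)%O] else p = 0.
  move=> A; case: (boolP (bad A)) => [/and3P[_ _ /lead_onto //]|_]; by exists 0.
pose Q A := (chain_coef z u A - cdiff w A) *: q A.
have IQ A : I (Q A).
  apply: IZ; have /= := hq A; by case: ifP => [_ [] //|_ ->].
pose z' A := z A - kdiff W A - Q A.
have zeroA A : #|A| != i -> [/\ z A = 0, kdiff W A = 0 & Q A = 0].
  move=> cA; split; first by case: (zc A) => _; apply; rewrite (negbTE cA).
    by apply/mpolyP => m; rewrite cW (negbTE cA) mcoeff0.
  by have /= := hq A; rewrite /bad (negbTE cA) /Q /= => ->; rewrite scaler0.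
have cdw A : cdiff (fun D : {set _} => if (ind D <= u)%MM then w D else 0) A = cdiff w A.
  by apply: eq_gdiff => k kA; case: ifP => // /negbT/bw ->.
have z'c : kchain i j z'.
  move=> A; case: (zc A) => hA hA0; split.
    case/andP=> cA _; rewrite cA ij /= in hA; rewrite homog_degE /z'.
    rewrite !(rpredB, rpredD) //.
    - by rewrite -homog_degE; apply: hA.
    - rewrite -homog_degE => m; rewrite mcoeff_msupp cW cA /=.
      have [e _|_] := eqVneq (m + ind A)%MM u; last by rewrite eqxx.
      by have := congr1 mdeg e; rewrite mdegD mdeg_ind (eqP cA) du => <-; rewrite addnK.
    - apply: rpredZ; have /= := hq A; case: ifP => [/and3P[_ Au _] [_ + _ _]|_ ->];
      last exact: rpred0.
      suff -> : mdeg (u - ind A) = (j - i)%N by [].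
      by rewrite -du -(submK Au) mdegD mdeg_ind (eqP cA) submK ?addnK.
  rewrite ij andbT => cA; rewrite /z'; have [-> -> ->] := zeroA A cA.
  by rewrite !subr0.
have kz' B : kdiff z' B = kdiff z B - kdiff (kdiff W) B - kdiff Q B.
  by rewrite -!gdiffB.
have z'cyc : cycle z'.
  move=> B cB i0; rewrite kz' (_ : kdiff (kdiff W) B = 0) ?subr0; last exact: gdiff_gdiff.
  by apply: IB; [apply: zcyc|apply: I_kdiff].
have [A m|w' [w'c hw']] := boundary_strict IH z'c z'cyc.
  rewrite mcoeff_msupp; apply: contraR; rewrite -leNgt le_eqVlt.
  have [cA|cA] := eqVneq #|A| i; last first.
    by rewrite /z'; have [-> -> ->] := zeroA A cA; rewrite !subr0 mcoeff0 eqxx.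
  rewrite !mcoeffB cW cA eqxx /= cdw mcoeffZ; case/orP=> [/eqP e|lt].
    have Au : (ind A <= u)%MM by rewrite e lem_addl.
    have em : m = (u - ind A)%MM by rewrite e addmK.
    rewrite -e eqxx [in chain_coef _ _ _]/chain_coef Au -em; have /= := hq A.
    rewrite /bad cA eqxx Au -em /=; case: ifP => [_ [_ _ -> _]|nG ->].
      by rewrite mulr1 subrr.
    rewrite mcoeff0 mulr0 subr0 -hw ?subrr // -?em ?nG //.
    by rewrite /chain_coef Au -em subrr.
  rewrite (gt_eqF lt) subr0 memN_msupp_eq0; last first.
    by apply/negP => /bz; rewrite leNgt lt.
  rewrite sub0r oppr_eq0; have /= := hq A; case: ifP => [/and3P[_ Au _] [_ _ _ le]|_ ->].
    rewrite mcoeff_gt_mlead ?mulr0 //; apply: le_lt_trans le _.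
    by rewrite -(ltmc_add2l _ _ (ind A)) submK.
  by rewrite mcoeff0 mulr0.
exists (fun A => W A + w' A); split.
  move=> D; case: (Wc D) => h1 h2; case: (w'c D) => h3 h4; split=> [cD|nD].
    by rewrite homog_degE; apply: rpredD; rewrite -homog_degE; [apply: h1|apply: h3].
  by rewrite h2 // h4 // addr0.
move=> A cA; have -> : z A - kdiff (fun A => W A + w' A) A = (z' A - kdiff w' A) + Q A.
  by rewrite (_ : kdiff _ A = kdiff W A + kdiff w' A) /z'; [ring|exact: gdiffD].
by apply: ID => //; apply: hw'.
Qed.

End Transfer.

(** * A complete intersection of quadrics *)

Section CompleteIntersection.
Variables (K : fieldType) (r : nat).
Local Notation T := {mpoly K[r]}.
Implicit Types (u v : 'X_{1..r}) (p q : T) (i k : 'I_r).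

(** The default 0 outside the range turns the first and last quadrics into pure squares. *)
Definition yvar (k : nat) : T := if insub k is Some i then 'X_i else 0.
Definition yprev (k : nat) : T := if k is k'.+1 then yvar k' else 0.

Definition ci_gen k : T := 'X_k * 'X_k - yvar k.+1 * yprev k.

Lemma yvar_neq0 (c : nat) : yvar c != 0 -> exists2 i : 'I_r, c = i & yvar c = 'X_i.
Proof. by rewrite /yvar; case: insubP => [i _ ei _|_]; [exists i|rewrite eqxx]. Qed.

(* The weights k (2 r - k) are strictly concave in k,
  so y_k^2 is the heaviest term of ci_gen k. *)
Definition wt v := (\sum_(i < r) i * (2 * r - i) * v i)%N.

Lemma wtD u v : wt (u + v) = (wt u + wt v)%N.
Proof. by rewrite /wt -big_split; apply: eq_bigr => i _; rewrite mnmDE mulnDr. Qed.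

Lemma wtU k : wt U_(k) = (k * (2 * r - k))%N.
Proof.
rewrite /wt (bigD1 k) //= mnm1E eqxx muln1 big1 ?addn0 // => i ik.
by rewrite mnm1E eq_sym (negbTE ik) muln0.
Qed.

Definition low c p := forall u, u \in msupp p -> (wt u < c)%N.

Lemma lowD c p q : low c p -> low c q -> low c (p + q).
Proof. by move=> h1 h2 u /msuppD_le; rewrite mem_cat => /orP[/h1|/h2]. Qed.

Lemma lowM c d p q : low c p -> (forall u, u \in msupp q -> (wt u <= d)%N) -> low (c + d) (p * q).
Proof.
move=> h1 h2 u /msuppM_le/allpairsP[[u1 u2] /= [/h1 lt /h2 le ->]].
by rewrite wtD -addSn leq_add.
Qed.

(** Different monomials may share a weight, so x^v is required to be the only term of its weight;
    this makes the passage to [ci_basis] triangular. *)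
Definition unitri v p := low (wt v) (p - 'X_[v]).

Lemma unitri_le v p u : unitri v p -> u \in msupp p -> (wt u <= wt v)%N.
Proof.
move=> h; rewrite -[p](subrK 'X_[v]) => /msuppD_le; rewrite mem_cat msuppX inE.
by case/orP=> [/h/ltnW|/eqP ->].
Qed.

Lemma unitriX v : unitri v 'X_[v].
Proof. by move=> u; rewrite subrr msupp0. Qed.

Lemma unitriM u v p q : unitri u p -> unitri v q -> unitri (u + v)%MM (p * q).
Proof.
move=> hp hq; rewrite /unitri wtD mpolyXD.
have -> : p * q - 'X_[u] * 'X_[v] = (p - 'X_[u]) * q + (q - 'X_[v]) * 'X_[u] by ring.
apply: lowD; first by apply: lowM => // w; apply: unitri_le.
by rewrite addnC; apply: lowM => // w; rewrite msuppX inE => /eqP ->.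
Qed.

Lemma unitriXn v p (k : nat) : unitri v p -> unitri (v *+ k)%MM (p ^+ k).
Proof.
move=> h; elim: k => [|k IH]; first by rewrite expr0 mulm0n -mpolyX0; apply: unitriX.
by rewrite exprS mulmS; apply: unitriM.
Qed.

Lemma low0 c : low c 0.
Proof. by move=> u; rewrite msupp0. Qed.

Lemma unitri_ci_gen k : unitri (U_(k) *+ 2)%MM (ci_gen k).
Proof.
have -> : (U_(k) *+ 2 = U_(k) + U_(k))%MM by rewrite mulmS mulm1n.
rewrite /unitri /ci_gen mpolyXD addrAC subrr add0r wtD wtU /yprev /yvar.
case: insubP => [i ki ei|_]; last by rewrite mul0r oppr0; apply: low0.
case ek: (nat_of_ord k) => [|k']; first by rewrite mulr0 oppr0; apply: low0.
case: insubP => [j kj ej|_]; last by rewrite mulr0 oppr0; apply: low0.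
move=> u; rewrite (perm_mem (msuppN _)) -mpolyXD msuppX inE => /eqP ->.
rewrite wtD !wtU ei ej ek; have [s ->] : exists s, (2 * r = k'.+2 + s)%N.
  by exists (2 * r - k'.+2)%N; lia.
have -> : (k'.+2 + s - k'.+2 = s)%N by lia.
have -> : (k'.+2 + s - k' = s.+2)%N by lia.
have -> : (k'.+2 + s - k'.+1 = s.+1)%N by lia.
nia.
Qed.

Definition half_deg v := (\sum_(i < r) (v i)./2)%N.

Definition gpow (a : 'X_{1..r}) : T := \prod_(i < r) ci_gen i ^+ a i.

(** Each exponent is split as twice its half plus its parity: the squares become quadrics, counted
    by [half_deg], and the squarefree part is kept. *)
Definition ci_basis v : T := gpow [multinom (v i)./2 | i < r] * 'X_[[multinom (odd (v i) : nat)
  | i < r]].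

Lemma unitri_ci_basis v : unitri v (ci_basis v).
Proof.
have e : v = ((\sum_(i < r) (U_(i) *+ 2) *+ (v i)./2) + [multinom (odd (v i) : nat) | i < r])%MM.
  apply/mnmP => j; rewrite mnmDE mnm_sumE [X in (_ + X)%N]mnmE (bigD1 j) //= big1 => [|i ij].
    by rewrite !mulmnE mnm1E eqxx addn0 mul1n mul2n addnC odd_double_half.
  by rewrite !mulmnE mnm1E (negbTE ij).
rewrite {1}e; apply: unitriM; last exact: unitriX.
rewrite /gpow; elim/big_rec2: _ => [|i u p _ h]; first by rewrite -mpolyX0; apply: unitriX.
by apply: unitriM => //; rewrite mnmE; apply: unitriXn; apply: unitri_ci_gen.
Qed.

Lemma gpow_ci_basis a v : gpow a * ci_basis v = ci_basis (v + (a + a))%MM.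
Proof.
rewrite /ci_basis mulrA; congr (_ * _); last first.
  by congr mpolyX; apply/mnmP => i; rewrite !mnmE addnn oddD odd_double addbF.
rewrite /gpow -big_split; apply: eq_bigr => i _ /=.
by rewrite -exprD !mnmE addnn halfD odd_double andbF doubleK add0n addnC.
Qed.

Lemma half_degD v a : half_deg (v + (a + a))%MM = (half_deg v + mdeg a)%N.
Proof.
rewrite /half_deg mdegE -big_split; apply: eq_bigr => i _ /=.
by rewrite !mnmE addnn halfD odd_double andbF doubleK add0n.
Qed.

Definition ci_map q : T := \sum_(v <- msupp q) q@_v *: ci_basis v.

Lemma ci_map_widen q (s : seq 'X_{1..r}) : uniq s -> {subset msupp q <= s} ->
  ci_map q = \sum_(v <- s) q@_v *: ci_basis v.
Proof.
move=> us qs; rewrite [RHS](bigID (mem (msupp q))) /= [X in _ + X]big1 => [|v vq].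
  rewrite addr0 -[RHS]big_filter; apply: perm_big; apply: uniq_perm => //.
    exact: filter_uniq.
  by move=> v; rewrite mem_filter; case: (boolP (v \in msupp q)) => //= /qs ->.
by rewrite memN_msupp_eq0 ?scale0r.
Qed.

Lemma ci_mapD p q : ci_map (p + q) = ci_map p + ci_map q.
Proof.
pose s := undup (msupp p ++ msupp q).
have us : uniq s := undup_uniq _.
rewrite (@ci_map_widen p s) // => [|v h]; last by rewrite mem_undup mem_cat h.
rewrite (@ci_map_widen q s) // => [|v h]; last by rewrite mem_undup mem_cat h orbT.
rewrite (@ci_map_widen (p + q) s) // => [|v /msuppD_le h]; last by rewrite mem_undup.
by rewrite -big_split; apply: eq_bigr => v _; rewrite mcoeffD scalerDl.
Qed.

Lemma ci_mapZ c q : ci_map (c *: q) = c *: ci_map q.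
Proof.
rewrite (@ci_map_widen (c *: q) (msupp q)) //; last exact: msuppZ_le.
by rewrite scaler_sumr; apply: eq_bigr => v _; rewrite mcoeffZ scalerA.
Qed.

Lemma ci_mapX v : ci_map 'X_[v] = ci_basis v.
Proof. by rewrite /ci_map msuppX big_seq1 mcoeffX eqxx scale1r. Qed.

(** Stands for the t-th power of the ideal of the quadrics, described through the basis so that
    non-membership can be read off [half_deg]. It contains that power by [ci_pow_all], [ci_pow_D],
    [ci_pow_M] and [ci_pow_g]. *)
Definition ci_pow t p := exists2 q, (forall v, v \in msupp q ->
  (t <= half_deg v)%N) & p = ci_map q.

Lemma ci_pow_0 t : ci_pow t 0.
Proof. by exists 0; [move=> v; rewrite msupp0|rewrite /ci_map msupp0 big_nil]. Qed.

Lemma ci_pow_D t p q : ci_pow t p -> ci_pow t q -> ci_pow t (p + q).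
Proof.
move=> [p' hp ->] [q' hq ->]; exists (p' + q'); last by rewrite ci_mapD.
by move=> v /msuppD_le; rewrite mem_cat => /orP[/hp|/hq].
Qed.

Lemma ci_pow_Z t c p : ci_pow t p -> ci_pow t (c *: p).
Proof.
move=> [q h ->]; exists (c *: q); last by rewrite ci_mapZ.
by move=> v /msuppZ_le/h.
Qed.

Lemma ci_pow_ci_basis t v : (t <= half_deg v)%N -> ci_pow t (ci_basis v).
Proof. by move=> h; exists 'X_[v]; [move=> u; rewrite msuppX inE => /eqP ->|rewrite ci_mapX]. Qed.

(** The basis products span: replacing x^v by [ci_basis v] leaves a remainder of smaller weight, so
    induction on a weight bound applies. *)
Lemma ci_pow_all p : ci_pow 0 p.
Proof.
have [c hc] : exists c, low c p.
  exists (\max_(u <- msupp p) (wt u)).+1 => u up; rewrite ltnS.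
  exact: (leq_bigmax_seq (F := wt)).
elim: c p hc => [|c IH] p hc.
  suff -> : p = 0 by apply: ci_pow_0.
  by apply/mpolyP => v; rewrite mcoeff0; apply: memN_msupp_eq0; apply/negP => /hc.
rewrite [p]mpolyE big_seq; apply: (big_ind (ci_pow 0)) => [|? ?|v vp]; first exact: ci_pow_0.
  exact: ci_pow_D.
apply: ci_pow_Z; have -> : 'X_[v] =
  ci_basis v - (ci_basis v - 'X_[v]) by rewrite opprB addrC subrK.
apply: ci_pow_D; first exact: ci_pow_ci_basis.
rewrite -scaleN1r; apply: ci_pow_Z; apply: IH => u /(@unitri_ci_basis v); have := hc _ vp; lia.
Qed.

Lemma ci_pow_gpow a t p : ci_pow t p -> ci_pow (t + mdeg a) (gpow a * p).
Proof.
move=> [q hq ->]; rewrite /ci_map mulr_sumr big_seq.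
apply: (big_ind (ci_pow _)) => [|? ?|v /hq transversal]; [exact: ci_pow_0|exact: ci_pow_D|].
rewrite -scalerAr gpow_ci_basis; apply: ci_pow_Z; apply: ci_pow_ci_basis.
by rewrite half_degD leq_add2r.
Qed.

(** [p] times the squarefree part is expanded again in the basis; the quadrics already present are
    then multiplied back by [ci_pow_gpow], so their number cannot fall. *)
Lemma ci_pow_M t p q : ci_pow t q -> ci_pow t (p * q).
Proof.
move=> [q' hq ->]; rewrite /ci_map mulr_sumr big_seq.
apply: (big_ind (ci_pow _)) => [|? ?|v /hq transversal]; [exact: ci_pow_0|exact: ci_pow_D|].
rewrite -scalerAr /ci_basis mulrCA; apply: ci_pow_Z.
have [q2 h2 ->] := ci_pow_gpow [multinom (v i)./2 | i < r] (ci_pow_all (p * 'X_[[multinom (odd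
  (v i) : nat) | i < r]])).
exists q2 => // u /h2; apply: leq_trans; rewrite add0n mdegE (leq_trans transversal) //.
by rewrite /half_deg; apply: leq_sum => i _; rewrite mnmE.
Qed.

Lemma ci_pow_g t k p : ci_pow t p -> ci_pow t.+1 (ci_gen k * p).
Proof.
move=> /(ci_pow_gpow U_(k)%MM); rewrite mdeg1 addn1; congr (ci_pow _ (_ * _)).
rewrite /gpow (bigD1 k) //= mnm1E eqxx expr1 big1 ?mulr1 // => i ik.
by rewrite mnm1E eq_sym (negbTE ik).
Qed.

(* The heaviest monomials of p in ci_pow t come from distinct products ci_basis v,
  so they cannot cancel. *)
Lemma ci_pow_supp t p : ci_pow t p -> p != 0 -> exists2 v, v \in msupp p & (t <= half_deg v)%N.
Proof.
move=> [q hq ->] nz.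
have [v0 v0q] : exists v, v \in msupp q.
  case e: (msupp q) => [|v s]; last by exists v; rewrite mem_head.
  by move: nz; rewrite /ci_map e big_nil eqxx.
have [v vq vmax] : exists2 v, v \in msupp q & forall u, u \in msupp q -> (wt u <= wt v)%N.
  pose P c := has (fun v => wt v == c) (msupp q).
  have exP : exists c, P c by exists (wt v0); apply/hasP; exists v0.
  have ub c : P c -> (c <= \max_(u <- msupp q) wt u)%N.
    by case/hasP=> u uq /eqP <-; exact: (leq_bigmax_seq (F := wt)).
  case: (ex_maxnP exP ub) => c /hasP[v vq /eqP ev] cmax; exists v => // u uq.
  by rewrite ev; apply: cmax; apply/hasP; exists u.
exists v; last exact: hq.
rewrite mcoeff_msupp /ci_map raddf_sum /= (bigD1_seq v) //= big_seq_cond big1 ?addr0.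
  rewrite mcoeffZ mulf_neq0 //; first by rewrite -mcoeff_msupp.
  rewrite -[ci_basis v](subrK 'X_[v]) mcoeffD mcoeffX eqxx.
  rewrite memN_msupp_eq0 ?add0r ?oner_neq0 //.
  by apply/negP => /(@unitri_ci_basis v); rewrite ltnn.
move=> u /andP[uq uv]; rewrite mcoeffZ -[ci_basis u](subrK 'X_[u]) mcoeffD mcoeffX (negbTE uv)
  addr0.
rewrite [X in _ * X]memN_msupp_eq0 ?mulr0 //.
by apply/negP => /(@unitri_ci_basis u); rewrite ltnNge vmax.
Qed.

End CompleteIntersection.

(** * The graph of leading terms *)

Section LinearSpan.
Variables (R : nzRingType) (V : lmodType R).
Implicit Types (P : V -> Prop) (p q : V).

Inductive lspan P : V -> Prop :=
| lspan_nil : lspan P 0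
| lspan_cons c p q : P p -> lspan P q -> lspan P (c *: p + q).

Lemma lspan1 P p : P p -> lspan P p.
Proof. by move=> Pp; rewrite -[p]addr0 -[p]scale1r; apply: lspan_cons => //;
  apply: lspan_nil. Qed.

Lemma lspanD P p q : lspan P p -> lspan P q -> lspan P (p + q).
Proof.
move=> + Hq; elim=> [|c r s Pr _ IH]; first by rewrite add0r.
by rewrite -addrA; apply: lspan_cons.
Qed.

Lemma lspanZ P c p : lspan P p -> lspan P (c *: p).
Proof.
elim=> [|d r s Pr _ IH]; first by rewrite scaler0; apply: lspan_nil.
by rewrite scalerDr scalerA; apply: lspan_cons.
Qed.

Lemma lspanN P p : lspan P p -> lspan P (- p).
Proof. by rewrite -scaleN1r; apply: lspanZ. Qed.

Lemma lspanB P p q : lspan P p -> lspan P q -> lspan P (p - q).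
Proof. by move=> Pp Pq; apply: lspanD => //; apply: lspanN. Qed.

End LinearSpan.

Lemma lspan_map (R : nzRingType) (V W : lmodType R) (f : {linear V -> W})
    (P : V -> Prop) (Q : W -> Prop) :
  (forall p, P p -> lspan Q (f p)) -> forall p, lspan P p -> lspan Q (f p).
Proof.
move=> h p; elim=> [|c r s Pr _ IH]; first by rewrite linear0; apply: lspan_nil.
by rewrite linearP; apply: lspanD => //; apply: lspanZ; apply: h.
Qed.

Lemma lspan_sub (R : nzRingType) (V : lmodType R) (P Q : V -> Prop) :
  (forall p, P p -> lspan Q p) -> forall p, lspan P p -> lspan Q p.
Proof.
move=> h p; elim=> [|c r s Pr _ IH]; first exact: lspan_nil.
by apply: lspanD => //; apply: lspanZ; apply: h.
Qed.

(** * Edges, factorizations of monomials, and good edges *)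

Section Graph.
Variables (m n : nat).
Local Notation N := (m * n)%N.
Implicit Types (a b v x y z : 'I_N) (i j : 'I_m) (k l : 'I_n) (V : {set 'I_N})
  (s : seq ('I_N * 'I_N)) (u : 'X_{1..N}).

Lemma col_gt0 a : (0 < n)%N.
Proof. by case: n a => // -[? /=]; rewrite muln0. Qed.

Lemma row_of_subproof a : (a %/ n < m)%N.
Proof. by rewrite ltn_divLR ?(col_gt0 a). Qed.

Lemma col_of_subproof a : (a %% n < n)%N.
Proof. by rewrite ltn_mod (col_gt0 a). Qed.

Definition row_of a : 'I_m := Ordinal (row_of_subproof a).
Definition col_of a : 'I_n := Ordinal (col_of_subproof a).

Lemma row_of_var i k : row_of (var_idx i k) = i.
Proof. by apply: val_inj => /=; rewrite divnMDl ?divn_small ?addn0 //; case: k => //= k; lia. Qed.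

Lemma col_of_var i k : col_of (var_idx i k) = k.
Proof. by apply: val_inj => /=; rewrite modnMDl modn_small. Qed.

Lemma var_rwcl a : var_idx (row_of a) (col_of a) = a.
Proof. by apply: val_inj; rewrite /= -divn_eq. Qed.

Lemma varP a : {ik : 'I_m * 'I_n | a = var_idx ik.1 ik.2}.
Proof. by exists (row_of a, col_of a); rewrite /= var_rwcl. Qed.

Lemma rwcl_inj a b : row_of a = row_of b -> col_of a = col_of b -> a = b.
Proof. by move=> r c; rewrite -(var_rwcl a) -(var_rwcl b) r c. Qed.

Definition edge a b := (row_of a < row_of b)%N && (col_of b == (col_of a).+1 :> nat).

Definition edges s := all (fun e => edge e.1 e.2) s.

Lemma edge_var_idx i j k l : edge (var_idx i k) (var_idx j l) = (i < j)%N && (l == k.+1 :> nat).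
Proof. by rewrite /edge !row_of_var !col_of_var. Qed.

Definition corner a b := var_idx (row_of a) (col_of b).

Lemma corner_var_idx i j k l : corner (var_idx i k) (var_idx j l) = var_idx i l.
Proof. by rewrite /corner row_of_var col_of_var. Qed.

Definition edge_lead (e : 'I_N * 'I_N) : 'X_{1..N} := (U_(e.1) + U_(e.2))%MM.

(** The cofactor and the list of edges are kept apart because one monomial may have several
    factorizations, which the straightening compares. *)
Definition lead_rep (u : 'X_{1..N}) s : 'X_{1..N} := (u + \sum_(e <- s) edge_lead e)%MM.

Lemma lead_rep0 u : lead_rep u [::] = u.
Proof. by rewrite /lead_rep big_nil addm0. Qed.

Lemma lead_rep_cons u e s : lead_rep u (e :: s) = (edge_lead e + lead_rep u s)%MM.
Proof. by rewrite /lead_rep big_cons; apply/mnmP => i; rewrite !mnmDE; lia. Qed.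

Lemma lead_rep_cat u1 u2 s1 s2 : lead_rep (u1 + u2) (s1 ++ s2) =
  (lead_rep u1 s1 + lead_rep u2 s2)%MM.
Proof. by rewrite /lead_rep big_cat /=; apply/mnmP => i; rewrite !mnmDE; lia. Qed.

Lemma lead_rep_perm u s1 s2 : perm_eq s1 s2 -> lead_rep u s1 = lead_rep u s2.
Proof. by move=> h; rewrite /lead_rep; congr (_ + _)%MM; apply: perm_big. Qed.

Lemma lead_rep_mem e s u : e \in s -> (0 < lead_rep u s e.1)%N && (0 < lead_rep u s e.2)%N.
Proof.
move=> es; rewrite (lead_rep_perm _ (perm_to_rem es)) lead_rep_cons !mnmDE !mnm1E !eqxx.
by rewrite addn_gt0 addn_gt0 /= ?addn_gt0 orbT.
Qed.

Lemma lead_rep_supp u s v : (0 < lead_rep u s v)%N ->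
  (0 < u v)%N \/ exists2 e, e \in s & (e.1 == v) || (e.2 == v).
Proof.
elim: s => [|e s IH]; first by rewrite lead_rep0; left.
rewrite lead_rep_cons mnmDE /edge_lead mnmDE !mnm1E.
case: (boolP ((e.1 == v) || (e.2 == v))) => [h _|].
  by right; exists e; rewrite ?mem_head.
rewrite negb_or => /andP[/negbTE -> /negbTE ->] /IH[|[f fs h]]; first by left.
by right; exists f; rewrite // inE fs orbT.
Qed.

(** Exponents of the t-th power of the edge ideal; quantifying over tuples makes the predicate
    boolean. *)
Definition MonI t (u : 'X_{1..N}) : bool :=
  [exists s : t.-tuple ('I_N * 'I_N), edges s && (\sum_(e <- s) edge_lead e <= u)%MM].

Lemma MonIP t u :
  reflect (exists mm s, [/\ size s = t, edges s & u = lead_rep mm s]) (MonI t u).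
Proof.
apply: (iffP existsP) => [[s /andP[es le]]|[mm [s [ss es ->]]]].
  by exists (u - \sum_(e <- s) edge_lead e)%MM, s; rewrite size_tuple /lead_rep submK.
have ss' : size s == t by rewrite ss.
by exists (Tuple ss'); rewrite es lem_addl.
Qed.

Lemma MonI_up t u u' : (u <= u')%MM -> MonI t u -> MonI t u'.
Proof.
move=> le /existsP[s /andP[es h]]; apply/existsP; exists s.
by rewrite es (lepm_trans h le).
Qed.

(** The extremal choices force each neighbour of [x] in [V] to be adjacent to each neighbour of [y]
    in [V]. *)
Definition good V x y :=
  [/\ edge x y, {in V &, forall a b, edge a b -> col_of x <= col_of a}%N,
      {in V, forall b, col_of b = col_of y -> row_of b <= row_of y}%N
    & {in V, forall a, col_of a = col_of x -> row_of a < row_of y -> row_of a <= row_of x}%N].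

Lemma good_exists V : [exists a in V, [exists b in V, edge a b]] ->
  exists x y, [/\ x \in V, y \in V & good V x y].
Proof.
case/exists_inP => a0 a0V ha0.
case: (@arg_minnP _ a0 (fun a => (a \in V) && [exists b in V, edge a b]) col_of).
  by rewrite a0V.
move=> a /andP[aV /exists_inP[b0 b0V ab0]] amin.
case: (@arg_maxnP _ b0 (fun b => (b \in V) && (col_of b == col_of b0)) row_of).
  by rewrite b0V eqxx.
move=> y /andP[yV /eqP cy] ymax.
have cyS : col_of y = (col_of a).+1 :> nat by rewrite cy; case/andP: ab0 => _ /eqP.
case: (@arg_maxnP _ a (fun b => [&& b \in V,
  col_of b == col_of a & row_of b < row_of y]%N) row_of).
  rewrite aV eqxx; case/andP: ab0 => + _ => /leq_trans; apply; apply: ymax.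
  by rewrite b0V eqxx.
move=> x /and3P[xV /eqP cx xy] xmax; exists x, y; split=> //; split.
- by rewrite /edge xy cx cyS eqxx.
- move=> c d cV dV cd; rewrite cx; apply: amin; rewrite cV.
  by apply/exists_inP; exists d.
- by move=> b bV cb; apply: ymax; rewrite bV cb cy eqxx.
- by move=> c cV cc cy'; apply: xmax; rewrite cV cc cx eqxx.
Qed.

(** The products first differ at x_{i,k}, the earliest of the four variables, so the diagonal
    product is larger. *)
Lemma lt_swap i j k l : (i < j)%N -> (k < l)%N ->
  ((U_(var_idx i l) + U_(var_idx j k))%MM < (U_(var_idx i k) + U_(var_idx j l))%MM)%O.
Proof.
move=> ij kl; apply/ltmcP; first by rewrite !mdegD !mdeg1.
have ijn : (i * n + n <= j * n)%N by rewrite -mulSnr leq_mul2r ij orbT.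
have ln : (l < n)%N by [].
exists (var_idx i k) => [v /= lt|].
  rewrite !mnmDE !mnm1E -!val_eqE /=.
  by do 4 (case: eqP => [?|_]; first lia).
rewrite !mnmDE !mnm1E eqxx -!val_eqE /=.
by do 2 (case: eqP => [?|_]; first lia).
Qed.

End Graph.

Ltac mnm_lia := apply/mnmP => ?; rewrite ?(mnmDE, mnm0E); clear; lia.

(** * Straightening *)

Section Straightening.
Variables (K : fieldType) (m n : nat).
Local Notation N := (m * n)%N.
Local Notation S := {mpoly K[N]}.
Local Notation X i k := (xv K i k).
Local Notation vi i k := (@var_idx m n i k).
Implicit Types (a b v x y z : 'I_N) (i j h : 'I_m) (k l r : 'I_n) (V : {set 'I_N})
  (s : seq ('I_N * 'I_N)) (u : 'X_{1..N}) (p q : S).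

Definition edge_minor (e : 'I_N * 'I_N) : S :=
  'X_e.1 * 'X_e.2 - 'X_(corner e.1 e.2) * 'X_(corner e.2 e.1).

Lemma edge_minor_var i j k l : edge_minor (vi i k, vi j l) = X i k * X j l - X i l * X j k.
Proof. by rewrite /edge_minor /= !corner_var_idx. Qed.

Definition poly_rep u s : S := 'X_[u] * \prod_(e <- s) edge_minor e.

Lemma poly_rep_cat u1 u2 s1 s2 : poly_rep (u1 + u2) (s1 ++ s2) = poly_rep u1 s1 * poly_rep u2 s2.
Proof. by rewrite /poly_rep mpolyXD big_cat /=; ring. Qed.

Lemma poly_rep_perm u s1 s2 : perm_eq s1 s2 -> poly_rep u s1 = poly_rep u s2.
Proof. by move=> h; rewrite /poly_rep; congr (_ * _); apply: perm_big. Qed.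

Lemma dhomog_edge_minor (e : 'I_N * 'I_N) : edge_minor e \is 2.-homog.
Proof.
by rewrite /edge_minor; apply: rpredB; rewrite -mpolyXD dhomogX /= mdegD !mdeg1.
Qed.

Lemma poly_rep_cons u e s : poly_rep u (e :: s) = edge_minor e * poly_rep u s.
Proof. by rewrite /poly_rep big_cons mulrCA. Qed.

Lemma dhomog_poly_rep u s : poly_rep u s \is (mdeg (lead_rep u s)).-homog.
Proof.
elim: s => [|e s IH]; first by rewrite /poly_rep big_nil mulr1 lead_rep0 dhomogX /=.
rewrite lead_rep_cons mdegD poly_rep_cons; apply: dhomogM => //.
by rewrite /edge_lead mdegD !mdeg1; apply: dhomog_edge_minor.
Qed.

Definition rep t (Q : pred 'X_{1..N}) p := exists u s,
  [/\ size s = t, edges s, Q (lead_rep u s) & p = poly_rep u s].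

(** With [xpredT] this is the t-th power of J, by [rep_span_J]. With [below_mon u] it certifies that
    every summand leads below [u], as a Groebner basis argument requires. *)
Definition rep_span t Q := lspan (rep t Q).

Definition below_mon u : pred 'X_{1..N} := fun u' => (u' < u)%O.
Definition upto_mon u : pred 'X_{1..N} := fun u' => (u' <= u)%O.

Lemma rep_span_rep t (Q : pred _) u s : size s = t -> edges s -> Q (lead_rep u s) ->
  rep_span t Q (poly_rep u s).
Proof. by move=> h1 h2 h3; apply: lspan1; exists u, s. Qed.

Lemma rep_span_mul t t' u u' s p : size s = t' -> edges s ->
  rep_span t (below_mon u) p -> rep_span (t + t') (below_mon (u +
    lead_rep u' s)%MM) (p * poly_rep u' s).
Proof.
move=> ss es; elim=> [|c r q [u0 [s0 [ss0 es0 lt ->]]] _ IH].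
  by rewrite mul0r; apply: lspan_nil.
rewrite mulrDl -scalerAl -poly_rep_cat; apply: lspan_cons => //.
exists (u0 + u')%MM, (s0 ++ s); split=> //.
- by rewrite size_cat ss0 ss.
- by rewrite /edges all_cat; apply/andP.
- by rewrite /below_mon lead_rep_cat ltmc_add2l.
Qed.

Definition lead_repE := (lead_rep_cons, lead_rep0).

Lemma poly_rep1 u e : poly_rep u [:: e] = 'X_[u] * edge_minor e.
Proof. by rewrite /poly_rep big_seq1. Qed.

Lemma poly_rep2 u e f : poly_rep u [:: e; f] = 'X_[u] * (edge_minor e * edge_minor f).
Proof. by rewrite /poly_rep big_cons big_seq1. Qed.

Lemma tail_lt a b : edge a b -> ((U_(corner a b) + U_(corner b a))%MM < edge_lead (a, b))%O.
Proof.
have [[i k] ->] := varP a; have [[j l] ->] := varP b.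
rewrite edge_var_idx !corner_var_idx /= => /andP[ij /eqP lk]; apply: lt_swap => //.
by rewrite lk.
Qed.

(* Each exchange x (x'y) = x' (xy), (xy')(x'y) = (xy)(x'y') between products of leading
   terms lifts to a Pluecker-type relation whose remaining terms are smaller. *)

Lemma exch_koszul e f : edge e.1 e.2 -> edge f.1 f.2 ->
  rep_span 1 (below_mon (edge_lead e +
    edge_lead f)%MM) (poly_rep (edge_lead e) [:: f] - poly_rep (edge_lead f) [:: e]).
Proof.
case: e f => [a b] [c d] /= ab cd.
have -> : poly_rep (edge_lead (a, b)) [:: (c, d)] - poly_rep (edge_lead (c, d)) [:: (a, b)] =
  poly_rep (U_(corner a b) + U_(corner b a))%MM [:: (c, d)]
  - poly_rep (U_(corner c d) + U_(corner d c))%MM [:: (a, b)].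
  by rewrite !poly_rep1 /edge_minor /edge_lead /= !mpolyXD; ring.
apply: lspanB; apply: rep_span_rep; rewrite //= ?ab ?cd //.
  by rewrite !lead_repE /below_mon addmC ltmc_add2l tail_lt.
by rewrite !lead_repE /below_mon ltmc_add2r tail_lt.
Qed.

(** Expansion along its first column of the vanishing determinant with rows i', i, j and columns k,
    k, l. *)
Lemma exch_low i' i j k l : (i' < i < j)%N -> l = k.+1 :> nat ->
  rep_span 1 (below_mon (U_(vi i k) + U_(vi i' k) + U_(vi j l))%MM)
    (poly_rep U_(vi i k) [:: (vi i' k, vi j l)] - poly_rep U_(vi i' k) [:: (vi i k, vi j l)]).
Proof.
move=> /andP[h1 h2] lk; have kl : (k < l)%N by rewrite lk.
have -> : poly_rep U_(vi i k) [:: (vi i' k, vi j l)] - poly_rep U_(vi i' k) [:: (vi i k, vi j l)]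
  = poly_rep U_(vi j k) [:: (vi i' k, vi i l)].
  by rewrite !poly_rep1 !edge_minor_var /xv; ring.
apply: rep_span_rep; rewrite //= ?edge_var_idx ?h1 ?lk ?eqxx //.
rewrite !lead_repE /below_mon /edge_lead /=.
rewrite (_ : (_ + _)%MM = U_(vi i' k) + (U_(vi i l) + U_(vi j k)))%MM; last by mnm_lia.
rewrite (_ : (_ + U_(vi j l))%MM = U_(vi i' k) + (U_(vi i k) + U_(vi j l)))%MM; last by mnm_lia.
by rewrite ltmc_add2r lt_swap.
Qed.

(** Expansion along its last column of the vanishing determinant with rows i, j', j and columns k,
    l, l. *)
Lemma exch_high i j' j k l : (i < j' < j)%N -> l = k.+1 :> nat ->
  rep_span 1 (below_mon (U_(vi i k) + U_(vi j' l) + U_(vi j l))%MM)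
    (poly_rep U_(vi j l) [:: (vi i k, vi j' l)] - poly_rep U_(vi j' l) [:: (vi i k, vi j l)]).
Proof.
move=> /andP[h1 h2] lk; have kl : (k < l)%N by rewrite lk.
have -> : poly_rep U_(vi j l) [:: (vi i k, vi j' l)] - poly_rep U_(vi j' l) [:: (vi i k, vi j l)]
  = - poly_rep U_(vi i l) [:: (vi j' k, vi j l)].
  by rewrite !poly_rep1 !edge_minor_var /xv; ring.
apply: lspanN; apply: rep_span_rep; rewrite //= ?edge_var_idx ?h2 ?lk ?eqxx //.
rewrite !lead_repE /below_mon /edge_lead /=.
rewrite (_ : (_ + U_(vi i l))%MM = U_(vi j l) + (U_(vi i l) + U_(vi j' k)))%MM; last by mnm_lia.
rewrite (_ : (_ + U_(vi j l))%MM = U_(vi j l) + (U_(vi i k) + U_(vi j' l)))%MM; last by mnm_lia.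
by rewrite ltmc_add2r lt_swap.
Qed.

(** The determinant on rows i, j, h and columns k, l, r is expanded along its first and its last
    column, and the results are compared. *)
Lemma exch_path i j h k l r : (i < j < h)%N -> l = k.+1 :> nat -> r = l.+1 :> nat ->
  rep_span 1 (below_mon (U_(vi i k) + U_(vi j l) + U_(vi h r))%MM)
    (poly_rep U_(vi i k) [:: (vi j l, vi h r)] - poly_rep U_(vi h r) [:: (vi i k, vi j l)]).
Proof.
move=> /andP[h1 h2] lk rl; have kl : (k < l)%N by rewrite lk.
have lr : (l < r)%N by rewrite rl.
have kr := ltn_trans kl lr; have h3 := ltn_trans h1 h2.
have -> : poly_rep U_(vi i k) [:: (vi j l, vi h r)] - poly_rep U_(vi h r) [:: (vi i k, vi j l)]
  = poly_rep U_(vi j k) [:: (vi i l, vi h r)] - poly_rep U_(vi h k) [:: (vi i l, vi j r)]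
    - poly_rep U_(vi j r) [:: (vi i k, vi h l)] + poly_rep U_(vi i r) [:: (vi j k, vi h l)].
  by rewrite !poly_rep1 !edge_minor_var /xv; ring.
have e : (U_(vi i k) + U_(vi j l) + U_(vi h r) = U_(vi h r) + (U_(vi i k) + U_(vi j l)))%MM.
  by mnm_lia.
have lt1 : ((U_(vi h r) + (U_(vi i l) + U_(vi j k)))%MM <
    (U_(vi i k) + U_(vi j l) + U_(vi h r))%MM)%O.
  by rewrite e ltmc_add2r lt_swap.
have lt2 : ((U_(vi i k) + (U_(vi j r) + U_(vi h l)))%MM <
    (U_(vi i k) + U_(vi j l) + U_(vi h r))%MM)%O.
  by rewrite -addmA ltmc_add2r lt_swap.
apply: lspanD; first apply: lspanB; first apply: lspanB; apply: rep_span_rep;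
  rewrite //= ?edge_var_idx ?h1 ?h2 ?h3 ?rl ?lk ?eqxx // !lead_repE /below_mon /edge_lead /=.
- by rewrite (_ : (_ + U_(vi j k))%MM = U_(vi h r) + (U_(vi i l) + U_(vi j k)))%MM //; mnm_lia.
- apply: lt_trans lt1.
  rewrite (_ : (_ + U_(vi h k))%MM = U_(vi i l) + (U_(vi j r) + U_(vi h k)))%MM; last by mnm_lia.
  rewrite (_ : (U_(vi h r) + _)%MM = U_(vi i l) + (U_(vi j k) + U_(vi h r)))%MM; last by mnm_lia.
  by rewrite ltmc_add2r lt_swap.
- by rewrite (_ : (_ + U_(vi j r))%MM = U_(vi i k) + (U_(vi j r) + U_(vi h l)))%MM //; mnm_lia.
- apply: lt_trans lt2.
  rewrite (_ : (_ + U_(vi i r))%MM = U_(vi h l) + (U_(vi i r) + U_(vi j k)))%MM; last by mnm_lia.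
  rewrite (_ : (U_(vi i k) + _)%MM = U_(vi h l) + (U_(vi i k) + U_(vi j r)))%MM; last by mnm_lia.
  by rewrite ltmc_add2r lt_swap.
Qed.

(** The three-term Pluecker relation for four rows in the columns k, l. *)
Lemma exch_cross i' i j' j k l : (i' < i)%N -> (i < j')%N -> (j' < j)%N -> l = k.+1 :> nat ->
  rep_span 2 (below_mon (edge_lead (vi i k, vi j l) + edge_lead (vi i' k, vi j' l))%MM)
    (poly_rep 0%MM [:: (vi i k, vi j' l); (vi i' k, vi j l)]
     - poly_rep 0%MM [:: (vi i k, vi j l); (vi i' k, vi j' l)]).
Proof.
move=> h1 h2 h3 lk; have kl : (k < l)%N by rewrite lk.
rewrite (_ : _ - _ = - poly_rep 0%MM [:: (vi i' k, vi i l); (vi j' k, vi j l)]); last first.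
  by rewrite !poly_rep2 !edge_minor_var mpolyX0; ring.
apply: lspanN; apply: rep_span_rep; rewrite //= ?edge_var_idx ?h1 ?h3 ?lk ?eqxx //.
rewrite !lead_repE /below_mon /edge_lead /=.
rewrite (_ : (_ + (_ + 0))%MM = U_(vi i' k) + U_(vi j l) + (U_(vi i l) + U_(vi j' k)))%MM;
  last by apply/mnmP => q; rewrite ?(mnmDE, mnm0E); lia.
rewrite (_ : (_ + (U_(vi i' k) + U_(vi j' l)))%MM
  = U_(vi i' k) + U_(vi j l) + (U_(vi i k) + U_(vi j' l)))%MM; last by mnm_lia.
by rewrite ltmc_add2r lt_swap.
Qed.

Lemma exch_across i j' j h k l r : (i < j')%N -> (j' < j)%N -> (j < h)%N ->
  l = k.+1 :> nat -> r = l.+1 :> nat ->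
  rep_span 2 (below_mon (edge_lead (vi i k, vi j l) + edge_lead (vi j' l, vi h r))%MM)
    (poly_rep 0%MM [:: (vi i k, vi j' l); (vi j l, vi h r)]
     - poly_rep 0%MM [:: (vi i k, vi j l); (vi j' l, vi h r)]).
Proof.
move=> h1 h2 h3 lk rl; have kl : (k < l)%N by rewrite lk.
have lr : (l < r)%N by rewrite rl.
have ij := ltn_trans h1 h2; have j'h := ltn_trans h2 h3; have ih := ltn_trans ij h3.
set u := (edge_lead (vi i k, vi j l) + edge_lead (vi j' l, vi h r))%MM.
rewrite (_ : _ - _ =
    poly_rep 0%MM [:: (vi j' k, vi h l); (vi i l, vi j r)]
    - poly_rep 0%MM [:: (vi i k, vi h l); (vi j' l, vi j r)]
    - poly_rep 0%MM [:: (vi j' k, vi j l); (vi i l, vi h r)]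
    - poly_rep 0%MM [:: (vi j k, vi h l); (vi i l, vi j' r)]); last first.
  by rewrite !poly_rep2 !edge_minor_var mpolyX0; ring.
have lt1 : ((U_(vi j l) + U_(vi h r) + (U_(vi i l) + U_(vi j' k)))%MM < u)%O.
  rewrite (_ : u = U_(vi j l) + U_(vi h r) + (U_(vi i k) + U_(vi j' l)))%MM; last first.
    by rewrite /u /edge_lead /=; mnm_lia.
  by rewrite ltmc_add2r lt_swap.
have lt2 : ((U_(vi j' l) + U_(vi h r) + (U_(vi i l) + U_(vi j k)))%MM < u)%O.
  rewrite (_ : u = U_(vi j' l) + U_(vi h r) + (U_(vi i k) + U_(vi j l)))%MM; last first.
    by rewrite /u /edge_lead /=; mnm_lia.
  by rewrite ltmc_add2r lt_swap.
apply: lspanB; first apply: lspanB; first apply: lspanB; apply: rep_span_rep;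
  rewrite //= ?edge_var_idx ?h1 ?h2 ?h3 ?ij ?ih ?j'h ?rl ?lk ?eqxx // !lead_repE /below_mon
    /edge_lead /=.
- apply: lt_trans lt1.
  rewrite (_ : (_ + (_ + 0))%MM = U_(vi i l) + U_(vi j' k) + (U_(vi j r) + U_(vi h l)))%MM;
    last by apply/mnmP => q; rewrite ?(mnmDE, mnm0E); lia.
  by rewrite addmC ltmc_add2l lt_swap.
- rewrite (_ : (_ + (_ + 0))%MM = U_(vi i k) + U_(vi j' l) + (U_(vi j r) + U_(vi h l)))%MM;
    last by apply/mnmP => q; rewrite ?(mnmDE, mnm0E); lia.
  rewrite (_ : u = U_(vi i k) + U_(vi j' l) + (U_(vi j l) + U_(vi h r)))%MM; last first.
    by rewrite /u /edge_lead /=; mnm_lia.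
  by rewrite ltmc_add2r lt_swap.
- rewrite (_ : (_ + (_ + 0))%MM = U_(vi j l) + U_(vi h r) + (U_(vi i l) + U_(vi j' k)))%MM //.
  by apply/mnmP => q; rewrite ?(mnmDE, mnm0E); lia.
- apply: lt_trans lt2.
  rewrite (_ : (_ + (_ + 0))%MM = U_(vi i l) + U_(vi j k) + (U_(vi j' r) + U_(vi h l)))%MM;
    last by apply/mnmP => q; rewrite ?(mnmDE, mnm0E); lia.
  by rewrite addmC ltmc_add2l lt_swap.
Qed.

End Straightening.

(** * Moving a factorization to one that uses a good edge *)

Section Exchange.
Variables (K : fieldType) (m n : nat).
Local Notation N := (m * n)%N.
Local Notation S := {mpoly K[N]}.
Implicit Types (a b v x y z : 'I_N) (V : {set 'I_N})
  (s : seq ('I_N * 'I_N)) (u mm : 'X_{1..N}) (p q : S).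

(** The equality of monomials serves the colon ideals; the span condition serves the Groebner
    basis. *)
Definition exchanged t x y mm s := exists mm' s',
  [/\ size s' = t, edges s', lead_rep mm' ((x, y) :: s') = lead_rep mm s
    & rep_span t.+1 (below_mon (lead_rep mm s)) (poly_rep K mm s - poly_rep K mm' ((x,
      y) :: s'))].

(** Extends an exchange among the few edges [s0] with cofactor [m0] to the whole product, by
    multiplying with the untouched [s1] and [m']. *)
Lemma exch_step t x y m0 m0' m' s s0 s0' s1 :
  perm_eq s (s0 ++ s1) -> edges s -> size s = t.+1 ->
  size s0 = (size s0').+1 -> edges s0' ->
  lead_rep m0 s0 = lead_rep m0' ((x, y) :: s0') ->
  rep_span (size s0) (below_mon (lead_rep m0 s0)) (poly_rep K m0 s0 - poly_rep K m0' ((x,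
    y) :: s0')) ->
  exchanged t x y (m0 + m')%MM s.
Proof.
move=> ps es ss ss0 es0' eu sp.
have es1 : edges s1.
  by move: es; rewrite /edges (perm_all _ ps) all_cat => /andP[].
have st : (size s0 + size s1)%N = t.+1 by rewrite -size_cat -(perm_size ps).
exists (m0' + m')%MM, (s0' ++ s1); split.
- by apply: succn_inj; rewrite -st ss0 size_cat.
- by rewrite /edges all_cat; apply/andP.
- by rewrite (lead_rep_perm _ ps) -cat_cons !lead_rep_cat eu.
rewrite (lead_rep_perm _ ps) (poly_rep_perm _ _ ps) -cat_cons !poly_rep_cat -mulrBl
  lead_rep_cat -st.
exact: rep_span_mul.
Qed.

Lemma addm_sub1 u v : (0 < u v)%N -> u = (U_(v) + (u - U_(v)))%MM.
Proof. by move=> h; rewrite addmC submK // lep1mP -lt0n. Qed.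

Lemma edge_neq a b : edge a b -> (a == b) = false.
Proof. by case/andP=> h _; apply/eqP => e; move: h; rewrite e ltnn. Qed.

(** Unless xy is already a factor, [x] comes from the cofactor or an edge xb, and [y] from the
    cofactor, an edge yh or an edge ay. With [x] in the cofactor these cases are [exch_koszul],
    [exch_path] and [exch_low]; with an edge xb they are [exch_high], [exch_across] and
    [exch_cross]. *)
Lemma exchange V t mm s x y : good V x y ->
  (forall v, (0 < lead_rep mm s v)%N -> v \in V) ->
  size s = t.+1 -> edges s ->
  (0 < lead_rep mm s x)%N -> (0 < lead_rep mm s y)%N -> exchanged t x y mm s.
Proof.
case=> exy minx maxy maxx uV ss es ux uy.
have eV e : e \in s -> [/\ e.1 \in V, e.2 \in V & edge e.1 e.2].
  move=> h; have /andP[h1 h2] := lead_rep_mem mm h.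
  by split; [apply: uV|apply: uV|exact: (allP es _ h)].
have [xys|xys] := boolP ((x, y) \in s).
  exists mm, (rem (x, y) s); have ps := perm_to_rem xys; split.
  - by rewrite size_rem // ss.
  - by move: es; rewrite /edges (perm_all _ ps) => /andP[].
  - by rewrite -(lead_rep_perm _ ps).
  - by rewrite -(poly_rep_perm _ _ ps) subrr; apply: lspan_nil.
(* An edge ending at [x] would start one column earlier, against the choice of the first column. *)
have atx e : e \in s -> e.2 != x.
  move=> /eV[aV bV ab]; apply/eqP => e2; have := minx _ _ aV bV ab.
  by case/andP: ab => _ /eqP; rewrite e2 => ->; rewrite ltnn.
have xedge e : e \in s -> e.1 = x ->
  exists2 b, e = (x, b) & [/\ col_of b = col_of y,
    (row_of x < row_of b)%N & (row_of b < row_of y)%N].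
  case: e => a b h /= e1; subst a; exists b => //; have [_ /= bV /andP[/= xb /eqP cb]] := eV _ h.
  have cby : col_of b = col_of y by apply: val_inj; apply: etrans cb _;
    case/andP: exy => _ /eqP e; exact: esym e.
  split=> //; rewrite ltn_neqAle maxy // andbT.
  by apply: contraNneq xys => r; rewrite -(@rwcl_inj m n b y (val_inj (r : val (row_of b) =
    val (row_of y))) cby).
have yedge1 e : e \in s -> e.2 = y ->
  exists2 a, e = (a, y) & col_of a = col_of x /\ (row_of a < row_of x)%N.
  case: e => a b h /= e2; subst b; exists a => //; have [/= aV _ /andP[/= ay /eqP cy]] := eV _ h.
  have cax : col_of a = col_of x by apply: val_inj; apply: succn_inj;
    apply: etrans (esym cy) _; case/andP: exy => _ /eqP.
  split=> //; rewrite ltn_neqAle maxx // andbT.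
  by apply: contraNneq xys => r; rewrite -(@rwcl_inj m n a x (val_inj (r : val (row_of a) =
    val (row_of x))) cax).
have exy' := exy; move: exy' => /andP[rxy /eqP cxy].
have vx := var_rwcl x; have vy := var_rwcl y.
have xy := edge_neq exy.
case: (lead_rep_supp ux) => [mx|[e es1 /orP[/eqP e1|/eqP e2]]]; last first.
- by have := atx _ es1; rewrite e2 eqxx.
- have [b ee [cb xb by']] := xedge _ es1 e1; rewrite {}ee {e1} in es1.
  have var_down := var_rwcl b; rewrite cb in var_down.
  have ps := perm_to_rem es1; set s1 := rem _ s in ps.
  case: (lead_rep_supp uy) => [my|[f fs /orP[/eqP f1|/eqP f2]]].
  + rewrite (addm_sub1 my).
    apply: (@exch_step _ _ _ _ U_(b)%MM _ _ [:: (x, b)] [::] s1) => //.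
      by rewrite !lead_rep_cons !lead_rep0 /edge_lead /=; mnm_lia.
    rewrite !lead_rep_cons !lead_rep0 /edge_lead /= -vx -vy -var_down; apply: exch_high => //.
    by rewrite xb.
  + have {}fs : f \in s1.
      have := perm_mem ps f; rewrite fs inE => /esym/orP[/eqP ef|//].
      by move: xy; rewrite -f1 ef eqxx.
    have fs' : f \in s by rewrite (perm_mem ps) inE fs orbT.
    case: f f1 fs fs' => y' h /= -> fs fs'; have [_ _ /andP[/= yh /eqP ch]] := eV _ fs'.
    have ps2 := perm_to_rem fs; set s2 := rem _ s1 in ps2.
    have vh := var_rwcl h.
    rewrite -[mm]add0m.
    apply: (@exch_step _ _ _ _ 0%MM _ _ [:: (x, b); (y, h)] [:: (b, h)] s2) => //.
    * by apply: perm_trans ps _; rewrite /= perm_cons.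
    * by rewrite /edges all_seq1 /edge [fst _]/= [snd _]/= cb (ltn_trans by' yh) /=; apply/eqP.
    * by rewrite !lead_rep_cons !lead_rep0 /edge_lead /=; mnm_lia.
    rewrite !lead_rep_cons lead_rep0 addm0.
    rewrite (_ : (edge_lead (x, b) + edge_lead (y, h))%MM = (edge_lead (x, y) + edge_lead (b,
      h))%MM); last first.
      by rewrite /edge_lead /=; mnm_lia.
    rewrite -vx -vy -var_down -vh; exact: exch_across.
  + have [a ef [ca ax]] := yedge1 _ fs f2; rewrite {}ef {f f2} in fs.
    have var_up := var_rwcl a; rewrite ca in var_up.
    have {}fs : (a, y) \in s1.
      have := perm_mem ps (a, y); rewrite fs inE => /esym/orP[/eqP [e0 _]|//].
      by move: ax; rewrite e0 ltnn.
    have ps2 := perm_to_rem fs; set s2 := rem _ s1 in ps2.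
    rewrite -[mm]add0m.
    apply: (@exch_step _ _ _ _ 0%MM _ _ [:: (x, b); (a, y)] [:: (a, b)] s2) => //.
    * by apply: perm_trans ps _; rewrite /= perm_cons.
    * by rewrite /edges all_seq1 /edge [fst _]/= [snd _]/= cb ca (ltn_trans ax xb) /=; apply/eqP.
    * by rewrite !lead_rep_cons !lead_rep0 /edge_lead /=; mnm_lia.
    rewrite !lead_rep_cons lead_rep0 addm0.
    rewrite (_ : (edge_lead (x, b) + edge_lead (a, y))%MM = (edge_lead (x, y) + edge_lead (a,
      b))%MM); last first.
      by rewrite /edge_lead /=; mnm_lia.
    rewrite -vx -vy -var_down -var_up; exact: exch_cross.
have mm1 := addm_sub1 mx.
case: (lead_rep_supp uy) => [my|[f fs /orP[/eqP f1|/eqP f2]]].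
- have my' : (0 < (mm - U_(x))%MM y)%N by rewrite mnmBE mnm1E xy subn0.
  case: s ss es {ux uy uV eV xys atx xedge yedge1} => // e s1 ss es.
  rewrite mm1 (addm_sub1 my') addmA.
  apply: (@exch_step _ _ _ (edge_lead (x, y)) (edge_lead e) _ _ [:: e] [::] s1) => //.
    by rewrite !lead_rep_cons !lead_rep0 addmC.
  rewrite !lead_rep_cons !lead_rep0 addmC; apply: exch_koszul => //.
  by case/andP: es.
- case: f f1 fs => y' h /= -> fs.
  have ps := perm_to_rem fs; set s1 := rem _ s in ps; have [_ _ /andP[/= yh /eqP ch]] := eV _ fs.
  have vh := var_rwcl h; rewrite mm1.
  apply: (@exch_step _ _ _ _ U_(h)%MM _ _ [:: (y, h)] [::] s1) => //.
    by rewrite !lead_rep_cons !lead_rep0 /edge_lead /=; mnm_lia.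
  rewrite !lead_rep_cons !lead_rep0 /edge_lead /= -vx -vy -vh addmC addmA; apply: exch_path => //.
  by rewrite rxy.
have [a ef [ca ax]] := yedge1 _ fs f2; rewrite {}ef {f f2} in fs.
have ps := perm_to_rem fs; set s1 := rem _ s in ps.
have var_up := var_rwcl a; rewrite ca in var_up.
rewrite mm1.
apply: (@exch_step _ _ _ _ U_(a)%MM _ _ [:: (a, y)] [::] s1) => //.
  by rewrite !lead_rep_cons !lead_rep0 /edge_lead /=; mnm_lia.
rewrite !lead_rep_cons !lead_rep0 /edge_lead /= -vx -vy -var_up addmC addmA;
  apply: exch_low => //.
by rewrite ax.
Qed.

End Exchange.

(** * Groebner bases of the powers *)

Section IdealGen.
Variables (K : fieldType) (N : nat).
Local Notation S := {mpoly K[N]}.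
Implicit Types (G I : S -> Prop) (p q : S).

Lemma ideal_genP G p : ideal_gen G p <->
  exists2 ps : seq (S * S), (forall x, x \in ps -> G x.2) & p = \sum_(x <- ps) x.1 * x.2.
Proof.
split=> [[cs [gs [sz [gG ->]]]]|[ps psG ->]].
  exists (zip cs gs) => [[c g] h|].
    by apply: gG; rewrite -(@unzip2_zip _ _ cs gs) ?sz //; apply/mapP; exists (c, g).
  rewrite (big_nth (0, 0)) big_mkord size_zip sz minnn.
  by apply: eq_bigr => k _; rewrite nth_zip.
exists (unzip1 ps), (unzip2 ps); rewrite !size_map; split=> //; split.
  by move=> g /mapP[x xps ->]; apply: psG.
rewrite (big_nth (0, 0)) big_mkord; apply: eq_bigr => k _.
by rewrite (nth_map (0, 0)) // (nth_map (0, 0)).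
Qed.

Lemma ideal_gen_mem G p : G p -> ideal_gen G p.
Proof.
move=> Gp; apply/ideal_genP; exists [:: (1, p)]; last by rewrite big_seq1 mul1r.
by move=> x; rewrite inE => /eqP ->.
Qed.

Lemma ideal_gen0 G : ideal_gen G 0.
Proof. by apply/ideal_genP; exists [::]; rewrite ?big_nil. Qed.

Lemma ideal_genD G p q : ideal_gen G p -> ideal_gen G q -> ideal_gen G (p + q).
Proof.
move=> /ideal_genP[ps hp ->] /ideal_genP[qs hq ->]; apply/ideal_genP.
exists (ps ++ qs); last by rewrite big_cat.
by move=> x; rewrite mem_cat => /orP[/hp|/hq].
Qed.

Lemma ideal_genM G p q : ideal_gen G q -> ideal_gen G (p * q).
Proof.
move=> /ideal_genP[qs hq ->]; apply/ideal_genP.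
exists [seq (p * x.1, x.2) | x <- qs]; first by move=> x /mapP[y /hq yq ->].
by rewrite big_map mulr_sumr; apply: eq_bigr => x _; rewrite mulrA.
Qed.

Lemma ideal_gen_min G I : I 0 -> (forall p q, I p -> I q -> I (p + q)) ->
  (forall p q, I q -> I (p * q)) -> (forall p, G p -> I p) ->
  forall p, ideal_gen G p -> I p.
Proof.
move=> I0 ID IM GI p /ideal_genP[ps hp ->]; rewrite big_seq.
by apply: big_ind => // x xp; apply: IM; apply/GI/hp.
Qed.

Lemma ideal_pow_prod I s : (forall q, q \in s -> I q) ->
  ideal_pow I (size s) (\prod_(q <- s) q).
Proof. by move=> h; apply: ideal_gen_mem; exists s. Qed.

End IdealGen.

(** * Leading terms and colon ideals of the powers *)

Section Groebner.
Variables (K : fieldType) (m n : nat).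
Local Notation N := (m * n)%N.
Local Notation S := {mpoly K[N]}.
Implicit Types (s : seq ('I_N * 'I_N)) (u mm : 'X_{1..N}) (p q : S).

Lemma lead_edge_minor (e : 'I_N * 'I_N) : edge e.1 e.2 ->
  mlead (@edge_minor K m n e) = edge_lead e /\ (@edge_minor K m n e)@_(edge_lead e) = 1.
Proof.
case: e => a b /= ab; rewrite /edge_minor /= -!mpolyXD; have lt := tail_lt ab.
have le : mlead ('X_[U_(a) + U_(b)] - 'X_[U_(corner a b) + U_(corner b a)] : S) = edge_lead (a,
  b).
  by rewrite mleadDl ?mleadN !mleadXm.
split=> //; rewrite mcoeffB !mcoeffX eqxx.
by rewrite (lt_eqF lt) subr0.
Qed.

Lemma lead_poly_rep u s : edges s ->
  mlead (poly_rep K u s) = lead_rep u s /\ (poly_rep K u s)@_(lead_rep u s) = 1.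
Proof.
elim: s => [|e s IH] es.
  by rewrite /poly_rep big_nil mulr1 lead_rep0 mleadXm mcoeffX eqxx.
case/andP: es => /lead_edge_minor[le ce] /IH[ls cs].
have nz p v : p@_v = 1 -> p != 0.
  by move=> h; apply: contra_eq_neq h => ->; rewrite mcoeff0 eq_sym oner_neq0.
rewrite poly_rep_cons lead_rep_cons mleadM ?(nz _ _ ce) ?(nz _ _ cs) // le ls; split=> //.
by rewrite -le -ls mleadcM le ls ce cs mulr1.
Qed.

Lemma rep_span_mono t (Q Q' : pred 'X_{1..N}) p :
  (forall u, Q u -> Q' u) -> rep_span t Q p -> rep_span t Q' p.
Proof.
move=> h; apply: lspan_sub => {}p [u [s [h1 h2 /h h3 h4]]].
by apply: lspan1; exists u, s.
Qed.

(** Both factorizations are exchanged for ones containing the same good edge; that common factor is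
    stripped and the induction on t compares the rest. *)
Lemma straighten t mm1 s1 mm2 s2 : size s1 = t -> size s2 = t ->
  edges s1 -> edges s2 -> lead_rep mm1 s1 = lead_rep mm2 s2 ->
  rep_span t (below_mon (lead_rep mm1 s1)) (poly_rep K mm1 s1 - poly_rep K mm2 s2).
Proof.
elim: t mm1 s1 mm2 s2 => [|t IH] mm1 s1 mm2 s2.
  move=> /size0nil -> /size0nil -> _ _; rewrite !lead_rep0 => ->.
  by rewrite subrr; apply: lspan_nil.
move=> ss1 ss2 es1 es2 e.
pose V := [set v | 0 < lead_rep mm1 s1 v]%N.
have [|x [y [xV yV gV]]] := @good_exists m n V.
  case: s1 ss1 es1 @V {e} => // f s1 _ es1 V;
    have /andP[h1 h2] := lead_rep_mem mm1 (mem_head f s1).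
  case/andP: es1 => ef _; apply/exists_inP; exists f.1; first by rewrite inE.
  by apply/exists_inP; exists f.2; rewrite ?inE.
rewrite !inE in xV yV.
have exy : edge x y by case: gV.
have [mm1' [s1' [ss1' es1' e1 sp1]]] : exchanged K t x y mm1 s1.
  by apply: (exchange K gV) => // v; rewrite inE.
have [mm2' [s2' [ss2' es2' e2 sp2]]] : exchanged K t x y mm2 s2.
  by apply: (exchange K gV) => //; rewrite -?e // => v; rewrite inE.
have e12 : lead_rep mm1' s1' = lead_rep mm2' s2'.
  by apply: (@addmI _ (edge_lead (x, y))); rewrite -!lead_rep_cons e1 e2.
have := rep_span_mul 0%MM (erefl (size [:: (x, y)])) _ (IH _ _ _ _ ss1' ss2' es1' es2' e12).
rewrite /edges all_seq1 => /(_ exy); rewrite addn1 -lead_rep_cat addm0 cats1.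
have -> : lead_rep mm1' (rcons s1' (x, y)) = lead_rep mm1 s1.
  by rewrite -e1; apply: lead_rep_perm; rewrite perm_rcons.
rewrite poly_rep1 mpolyX0 mul1r mulrBl => sp.
rewrite -e in sp2; have := lspanB (lspanD sp1 sp) sp2.
rewrite /poly_rep !big_cons; congr (lspan _ _); ring.
Qed.

Lemma rep_span_coef t u p v : rep_span t (below_mon u) p -> (u <= v)%O -> p@_v = 0.
Proof.
move=> + uv; elim=> [|c q r [u0 [s [_ es lt ->]]] _ IH]; first exact: mcoeff0.
rewrite mcoeffD IH addr0 mcoeffZ mcoeff_gt_mlead ?mulr0 //.
by have [-> _] := lead_poly_rep u0 es; apply: lt_le_trans lt uv.
Qed.

(** By [straighten], all summands leading exactly at [u] merge into a multiple of one of them, so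
    their cancellation is visible in a single scalar. *)
Lemma rep_span_top t u p : rep_span t (upto_mon u) p -> rep_span t (below_mon u) p \/
  exists c mm s, [/\ size s = t, edges s,
    lead_rep mm s = u & rep_span t (below_mon u) (p - c *: poly_rep K mm s)].
Proof.
elim=> [|c q r [u0 [s [ss es le ->]]] _ IH]; first by left; apply: lspan_nil.
move: le; rewrite /upto_mon le_eqVlt => /orP[/eqP e|lt]; last first.
  have lspq : rep_span t (below_mon u) (c *: poly_rep K u0 s) by apply: lspanZ;
    apply: rep_span_rep.
  case: IH => [h|[c' [mm [s' [h1 h2 h3 h4]]]]]; first by left; apply: lspanD.
  by right; exists c', mm, s'; split=> //; rewrite -addrA; apply: lspanD.
right; case: IH => [h|[c' [mm [s' [h1 h2 h3 h4]]]]].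
  by exists c, u0, s; split=> //; rewrite addrAC subrr add0r.
exists (c + c'), mm, s'; split=> //.
have -> : c *: poly_rep K u0 s + r - (c + c') *: poly_rep K mm s' =
  c *: (poly_rep K u0 s - poly_rep K mm s') + (r - c' *: poly_rep K mm s').
  by rewrite scalerBr scalerDl opprD addrACA.
apply: lspanD => //; apply: lspanZ; rewrite -e; apply: straighten => //.
by rewrite e h3.
Qed.

Lemma rep_span_bound t (Q : pred 'X_{1..N}) p : rep_span t Q p ->
  p = 0 \/ exists2 u, Q u & rep_span t (upto_mon u) p.
Proof.
elim=> [|c q r [u0 [s [ss es Qu ->]]] _ IH]; first by left.
right; case: IH => [->|[u Qu' sp]].
  exists (lead_rep u0 s) => //; rewrite addr0; apply: lspanZ; apply: rep_span_rep => //;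
    exact: lexx.
have [le|/ltW le] := leP (lead_rep u0 s) u.
  by exists u => //; apply: lspanD => //; apply: lspanZ; apply: rep_span_rep.
exists (lead_rep u0 s) => //; apply: lspanD.
  by apply: lspanZ; apply: rep_span_rep => //; exact: lexx.
by apply: rep_span_mono sp => v /le_trans; apply.
Qed.

(** Descent on the bound [u]: if the merged top coefficient vanishes, the bound drops; otherwise [u]
    is the leading exponent and carries a factorization into t edges. *)
Theorem groebner t p : rep_span t xpredT p -> p != 0 -> MonI t (mlead p).
Proof.
case/rep_span_bound => [->|[u _]]; first by rewrite eqxx.
elim/(@ltmwf N): u p => u IH p sp nz.
case: (rep_span_top sp) => [/rep_span_bound[e|[u' lt sp']]|].
- by rewrite e eqxx in nz.
- exact: IH lt _ sp' nz.
case=> c [mm [s [ss es e sp']]]; have [c0|c0] := eqVneq c 0.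
  rewrite c0 scale0r subr0 in sp'; case/rep_span_bound: sp' => [e'|[u' lt sp']].
    by rewrite e' eqxx in nz.
  exact: IH lt _ sp' nz.
have [lr cr] := lead_poly_rep mm es; rewrite e in lr cr.
have pu : p@_u = c.
  have := rep_span_coef sp' (lexx u); rewrite mcoeffB mcoeffZ cr mulr1.
  by move/eqP; rewrite subr_eq0 => /eqP.
suff -> : mlead p = u by apply/MonIP; exists mm, s.
apply/eqP; rewrite eq_le; apply/andP; split; last first.
  by apply: msupp_le_mlead; rewrite mcoeff_msupp pu.
rewrite leNgt; apply/negP => lt; have := mlead_supp nz.
rewrite mcoeff_msupp -[p](subrK (c *: poly_rep K mm s)) [X in mlead X]subrK.
rewrite mcoeffD (rep_span_coef sp' (ltW lt)) add0r mcoeffZ mcoeff_gt_mlead ?mulr0 ?eqxx //.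
by rewrite lr.
Qed.

Lemma spnM t1 t2 p q : rep_span t1 xpredT p -> rep_span t2 xpredT q ->
  rep_span (t1 + t2) xpredT (p * q).
Proof.
move=> sp; elim=> [|c r q' [u [s [ss es _ ->]]] _ IH]; first by rewrite mulr0; apply: lspan_nil.
rewrite mulrDr -scalerAr; apply: lspanD => //; apply: lspanZ.
elim: sp => [|d r' q'' [u' [s' [ss' es' _ ->]]] _ IH']; first by rewrite mul0r; apply: lspan_nil.
rewrite mulrDl -scalerAl -poly_rep_cat; apply: lspanD => //; apply: lspanZ.
apply: rep_span_rep => //; first by rewrite size_cat ss ss'.
by rewrite /edges all_cat; apply/andP.
Qed.

Lemma rep_span_all p : rep_span 0 xpredT p.
Proof.
rewrite [p]mpolyE; apply: big_ind => [|q r|v _]; first exact: lspan_nil.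
  exact: lspanD.
apply: lspanZ; have -> : 'X_[v] = poly_rep K v [::] by rewrite /poly_rep big_nil mulr1.
exact: rep_span_rep.
Qed.

Lemma rep_span_J t p : ideal_pow (JKP K m n) t p <-> rep_span t xpredT p.
Proof.
split.
  apply: ideal_gen_min => [|q r|q r|q]; first exact: lspan_nil.
  - exact: lspanD.
  - by move=> h; rewrite -[t]add0n; apply: spnM => //; apply: rep_span_all.
  case=> s [<- [sJ ->]] {q t p}; elim: s sJ => [|q s IH] sJ.
    rewrite big_nil; exact: rep_span_all.
  rewrite big_cons /= -add1n; apply: spnM; last first.
    by apply: IH => r rs; apply: sJ; rewrite inE rs orbT.
  move: (sJ q (mem_head q s)); apply: ideal_gen_min => [|q1 r|q1 r|q1].
  - exact: lspan_nil.
  - exact: lspanD.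
  - by move=> h; rewrite -[1%N]add0n; apply: spnM => //; apply: rep_span_all.
  case=> i [j [k [l [ij [lk ->]]]]]; rewrite -edge_minor_var.
  have -> : edge_minor K (var_idx i k, var_idx j l) = poly_rep K 0 [:: (var_idx i k,
    var_idx j l)].
    by rewrite poly_rep1 mpolyX0 mul1r.
  by apply: rep_span_rep; rewrite //= edge_var_idx ij lk eqxx.
elim=> [|c q r [u [s [<- es _ ->]]] _ IH]; first exact: ideal_gen0.
apply: ideal_genD => //; rewrite -mul_mpolyC /poly_rep mulrA; apply: ideal_genM.
rewrite -(size_map (@edge_minor K m n)) -(big_map (@edge_minor K m n) xpredT id).
apply: ideal_pow_prod => f /mapP[e es' ->]; apply: ideal_gen_mem.
exists (row_of e.1), (row_of e.2), (col_of e.1), (col_of e.2).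
have /andP[h1 /eqP h2] := allP es _ es'; split=> //; split=> //.
by rewrite -edge_minor_var !var_rwcl -surjective_pairing.
Qed.

(** This is in(J)^(t+1) : xy inside in(J)^t, for monomials supported on [V]: [exchange] makes xy one
    of the edges, and cancelling it leaves t of them. *)
Lemma MonI_good_colon V t u x y : good V x y -> x \in V -> y \in V ->
  (forall v, (0 < u v)%N -> v \in V) -> MonI t.+1 (u + U_(x) + U_(y))%MM -> MonI t u.
Proof.
move=> gV xV yV uV /MonIP[mm [s [ss es e]]].
have [|||mm' [s' [ss' es' e' _]]] := @exchange K m n V t mm s x y gV _ ss es.
- move=> v; rewrite -e !mnmDE !mnm1E; do 2 (case: eqP => [<- //|_]).
  by rewrite !addn0; apply: uV.
- by rewrite -e !mnmDE !mnm1E eqxx; lia.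
- by rewrite -e !mnmDE !mnm1E eqxx; lia.
apply/MonIP; exists mm', s'; split=> //; apply: (@addmI _ (edge_lead (x, y))).
by rewrite -lead_rep_cons e' -e /edge_lead /= addmC addmA.
Qed.

End Groebner.

(** * The upper bound *)

Section UpperBound.
Variables (K : fieldType) (m n : nat).
Local Notation N := (m * n)%N.
Implicit Types (a b v x y : 'I_N) (V W : {set 'I_N}) (u : 'X_{1..N}).

Definition outside V u := [exists v, (v \notin V) && (0 < u v)%N].

(* The monomials of (in(J)^t : y) + (x_v : v notin V), without the colon if y = None. *)
Definition MonI_vars V t (y : option 'I_N) u :=
  MonI t (if y is Some y' then u + U_(y') else u)%MM || outside V u.

Lemma outsideP V u : reflect (forall v, (0 < u v)%N -> v \in V) (~~ outside V u).
Proof.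
apply: (iffP existsPn) => h v; last by apply/negP => /andP[/negP vV /h].
by move=> uv; have := h v; rewrite uv andbT negbK.
Qed.

Lemma outside_up V u u' : (u <= u')%MM -> outside V u -> outside V u'.
Proof.
move=> /mnm_lepP le /existsP[v /andP[vV uv]]; apply/existsP; exists v.
by rewrite vV (leq_trans uv).
Qed.

Lemma outsideD V u x : x \in V -> outside V (u + U_(x))%MM = outside V u.
Proof.
move=> xV; apply: eq_existsb => v; case: (boolP (v \in V)) => //= vV.
by rewrite mnmDE mnm1E; case: eqP vV => [<-|_]; rewrite ?xV // addn0.
Qed.

Lemma MonI_vars_up V t (y : option 'I_N) : upclosed (MonI_vars V t y).
Proof.
move=> u u' le /orP[h|/(outside_up le) h]; last by rewrite /MonI_vars h orbT.
apply/orP; left; apply: MonI_up h; case: y => // y; apply/mnm_lepP => i.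
by rewrite !mnmDE leq_add2r (mnm_lepP le).
Qed.

Lemma MonI_vars_addvar V t (y : option 'I_N) v : v \in V ->
  addvar v (MonI_vars V t y) =1 MonI_vars (V :\ v) t y.
Proof.
move=> vV u; rewrite /addvar /MonI_vars -orbA; congr (_ || _).
apply/orP/existsP => [[/existsP[w /andP[wV uw]]|uv]|[w /andP[]]].
- by exists w; rewrite uw !inE negb_and wV orbT.
- by exists v; rewrite uv !inE eqxx.
rewrite !inE negb_and negbK => /orP[/eqP ->|wV] uw; first by right.
by left; apply/existsP; exists w; rewrite wV.
Qed.

Lemma MonI_vars_colon V t y : y \in V -> colon y (MonI_vars V t None) =1 MonI_vars V t (Some y).
Proof. by move=> yV u; rewrite /colon /MonI_vars outsideD. Qed.

Lemma MonI_edge t u x y : edge x y -> MonI t u -> MonI t.+1 (u + U_(x) + U_(y))%MM.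
Proof.
move=> xy /MonIP[mm [s [ss es ->]]]; apply/MonIP; exists mm, ((x, y) :: s).
by rewrite /= ss; split=> //=; [rewrite xy|rewrite lead_rep_cons /edge_lead /=; mnm_lia].
Qed.

Lemma MonI_vars_good V t x y w z : good V x y -> x \in V -> y \in V ->
  (w = x /\ z = y) \/ (w = y /\ z = x) ->
  colon w (MonI_vars V t.+1 (Some z)) =1 MonI_vars V t None.
Proof.
move=> gV xV yV wz u; have wV : w \in V by case: wz => -[-> _].
have e : (u + U_(w) + U_(z) = u + U_(x) + U_(y))%MM.
  by case: wz => -[-> ->] //; mnm_lia.
rewrite /colon /MonI_vars outsideD //; have [o|/outsideP no] := boolP (outside V u).
  by rewrite !orbT.
rewrite !orbF e; apply/idP/idP; first exact: (MonI_good_colon K gV).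
by apply: MonI_edge; case: gV.
Qed.

(** No edge of a factorization inside [V] can touch [y], so [y] divides the cofactor and cancels
    there. *)
Lemma MonI_vars_isolated V t y : y \in V ->
  (forall v, v \in V -> ~~ edge v y && ~~ edge y v) ->
  MonI_vars V t (Some y) =1 MonI_vars V t None.
Proof.
move=> yV iso u; rewrite /MonI_vars; have [o|/outsideP no] := boolP (outside V u).
  by rewrite !orbT.
rewrite !orbF; apply/idP/idP; last by apply: MonI_up; apply: lem_addr.
case/MonIP => mm [s [ss es e]].
have eV f : f \in s -> f.1 \in V /\ f.2 \in V.
  move=> /(lead_rep_mem mm); rewrite -e !mnmDE !mnm1E => /andP[].
  by split; [move: a|move: b]; case: eqP => [<- //|_]; rewrite addn0 => /no.
have [|mmy|[f fs /orP[/eqP f1|/eqP f2]]] := @lead_rep_supp m n mm s y.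
- by rewrite -e mnmDE mnm1E eqxx addn1.
- apply/MonIP; exists (mm - U_(y))%MM, s; split=> //.
  apply: (@addIm _ U_(y)%MM); rewrite e {1}(addm_sub1 mmy) /lead_rep; mnm_lia.
- have [_ f2V] := eV _ fs; have /andP[_] := iso _ f2V.
  by rewrite -f1 (allP es _ fs).
- have [f1V _] := eV _ fs; have /andP[+ _] := iso _ f1V.
  by rewrite -f2 (allP es _ fs).
Qed.

Lemma MonI_vars_noedge V t : {in V &, forall a b, ~~ edge a b} ->
  outside V =1 MonI_vars V t.+1 None.
Proof.
move=> ne u; rewrite /MonI_vars; case: (boolP (outside V u)) => [|/outsideP no].
  by rewrite orbT.
rewrite orbF; apply: esym; apply: negbTE; apply/MonIP => -[mm [[|e s] [ss es eu]]] //.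
have := lead_rep_mem mm (mem_head e s); rewrite -eu => /andP[/no e1 /no e2].
by case/andP: es => + _; apply/negP; apply: ne.
Qed.

(** Columns count from 0, so left ends lie in columns n-1-d to n-2: at most d pairs of adjacent
    columns still carry edges. *)
Definition colbound V d := {in V &, forall a b, edge a b -> n.-1 <= col_of a + d}%N.

Lemma mdegBU u v : (0 < u v)%N -> mdeg u = (mdeg (u - U_(v))).+1.
Proof. by move=> h; rewrite {1}(addm_sub1 h) mdegD mdeg1. Qed.

Lemma colbound_sub W V d : W \subset V -> colbound V d -> colbound W d.
Proof. by move=> /subsetP WV h a b /WV aV /WV bV; apply: h. Qed.

(** * The colon by a vertex, treated through its neighbours *)

Section Star.
Variables (t d : nat) (y : 'I_N).
Hypothesis IHt : forall V, colbound V d.+1 -> forall i u,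
  (i + 2 * t + d.+1 < mdeg u + 2)%N -> exact K (MonI_vars V t None) i u.
Hypothesis cy : (n.-1 = col_of y + d)%N.

(** The regularity bound is 2t + d. The colon by a neighbour leaves in(J)^t with d+1 column pairs,
    hence 2(t-1) + (d+1), and the degree shift by 1 meets the bound exactly. Deleting the neighbour
    shrinks [W] until [y] is isolated. *)
Lemma exact_star W : y \in W -> colbound W d.+1 ->
  {in W, forall b, col_of b = col_of y -> row_of b <= row_of y}%N ->
  (forall V i u, V \subset W -> colbound V d -> (i + 2 * t.+1 + d < mdeg u + 2)%N ->
    exact K (MonI_vars V t.+1 None) i u) ->
  forall i u, (i + 2 * t.+1 + d < mdeg u + 2)%N -> exact K (MonI_vars W t.+1 (Some y)) i u.
Proof.
elim/(@ltn_ind): {W}_.+1 {-2}W (ltnSn #|W|) => c IHc W cW yW cbW ymax IHd i u hi.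
have step x : x \in W -> edge x y || edge y x ->
    colon x (MonI_vars W t.+1 (Some y)) =1 MonI_vars W t None ->
    exact K (MonI_vars W t.+1 (Some y)) i u.
  move=> xW xy eN; apply: (@exact_mid _ _ _ x); first exact: MonI_vars_up.
    move=> ux; apply: (@eq_exact _ _ (MonI_vars W t None)) => [v|]; first by rewrite eN.
    by apply: IHt => //; move: hi; rewrite (mdegBU ux); lia.
  apply: (@eq_exact _ _ (MonI_vars (W :\ x) t.+1 (Some y))) => [v|].
    by rewrite MonI_vars_addvar.
  have sWx : W :\ x \subset W by apply: subD1set.
  have nxy : y != x by case/orP: xy => /edge_neq; rewrite ?(eq_sym y) => ->.
  apply: (IHc #|W :\ x|.+1) => //.
  - by move: cW; rewrite (cardsD1 x W) xW add1n.
  - by rewrite !inE nxy.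
  - exact: colbound_sub cbW.
  - by move=> b bW; apply: ymax; apply: (subsetP sWx).
  - by move=> V i' u' VW; apply: IHd; apply: subset_trans VW sWx.
have cle a b : a \in W -> b \in W -> edge a b -> (col_of y <= (col_of a).+1)%N.
  by move=> aW bW ab; have := cbW a b aW bW ab; rewrite cy; lia.
(* Neighbours in the column before [y] go first; the one in the largest row forms a good edge with
   [y]. *)
have [/exists_inP[a0 a0W ay0]|nolow] := boolP [exists a in W, edge a y].
  case: (@arg_maxnP _ a0 (fun a => (a \in W) && edge a y) (fun a : 'I_N => row_of a));
    first by rewrite a0W.
  move=> x /andP[xW xy] xmax; apply: (step x) => //; first by rewrite xy.
  apply: (@MonI_vars_good _ _ x y) => //; last by left.
  have /andP[_ /eqP cxy] := xy.
  split=> // [a b aW bW ab|a aW ca ra]; first by have := cle a b aW bW ab; rewrite cxy.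
  by apply: xmax; rewrite aW /edge ra ca cxy /=.
(* Without left neighbours of [y], no edge of [W] starts in the previous column, so [y] can be the
   left end of a good edge. *)
have [/exists_inP[b0 b0W yb0]|nohigh] := boolP [exists b in W, edge y b].
  case: (@arg_maxnP _ b0 (fun b => (b \in W) && edge y b) (fun a : 'I_N => row_of a));
    first by rewrite b0W.
  move=> x /andP[xW yx] xmax; apply: (step x) => //; first by rewrite yx orbT.
  apply: (@MonI_vars_good _ _ y x) => //; last by right.
  have /andP[ryx /eqP cyx] := yx.
  split=> // [a b aW bW ab|b bW cb|a aW ca _]; last exact: ymax.
    have := cle a b aW bW ab; rewrite leq_eqVlt => /orP[/eqP e|//].
    case/negP: nolow; apply/exists_inP; exists a => //.
    have /andP[rab /eqP cab] := ab.
    rewrite /edge e eqxx andbT; apply: leq_trans rab (ymax _ bW _).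
    by apply: val_inj; rewrite /= in cab e *; rewrite cab e.
  rewrite leqNgt; apply/negP => lt; have : (row_of b <= row_of x)%N.
    by apply: xmax; rewrite bW /edge (ltn_trans ryx lt) cb cyx /=.
  by rewrite leqNgt lt.
move: nolow nohigh => /exists_inPn nolow /exists_inPn nohigh.
apply: (@eq_exact _ _ (MonI_vars W t.+1 None)) => [v|].
  by rewrite MonI_vars_isolated // => a aW; rewrite nolow // nohigh.
(* An edge from the previous column ends no lower than the row of [y], so its left end would be a
   neighbour of [y]; hence a column pair is used up. *)
apply: IHd => // a b aW bW ab; rewrite cy leq_add2r.
have := cle a b aW bW ab; rewrite leq_eqVlt => /orP[/eqP e|//].
have /negP[] := nolow _ aW; have /andP[rab /eqP cab] := ab.
rewrite /edge e eqxx andbT; apply: leq_trans rab (ymax _ bW _).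
by apply: val_inj; rewrite /= in cab e *; rewrite cab e.
Qed.

End Star.

(** The inequality means mdeg u - i > 2(t-1) + d, written without subtraction. Induction on t, then
    on d + #|V|: the colon by [y] is [exact_star] with a smaller d, and deleting [y] shrinks [V]. *)
Lemma exact_MonI_vars t V d : colbound V d -> forall i u,
  (i + 2 * t + d < mdeg u + 2)%N -> exact K (MonI_vars V t None) i u.
Proof.
elim: t V d => [|t IHt] V d.
  move=> _ i u _; apply: exact_all => v; rewrite /MonI_vars; apply/orP; left.
  by apply/MonIP; exists v, [::]; rewrite lead_rep0.
elim/(@ltn_ind): {V d}(_ + _).+1 {-2}V {-2}d (ltnSn (d + #|V|)) => c IHc V d cV cb i u hi.
have [|noedge] := boolP [exists a in V, [exists b in V, edge a b]]; last first.
  apply: (@eq_exact _ _ (outside V)); last by apply: exact_vars; lia.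
  apply: MonI_vars_noedge => a b aV bV; apply: contra noedge => ab.
  by apply/exists_inP; exists a => //; apply/exists_inP; exists b.
case/good_exists => x [y [xV yV gV]].
have [/andP[rxy /eqP cxy] minx maxy maxx] := gV.
have cyn : (col_of y <= n.-1)%N by have := ltn_ord (col_of y); lia.
(* Counts the column pairs from the column of [y] on. As [y] lies one column after the left end [x],
   d' < d, which compensates for the degree of [y]. *)
pose d' := (n.-1 - col_of y)%N.
have ed' : (n.-1 = col_of y + d')%N by rewrite subnKC.
have dd : (d' < d)%N.
  by have := cb x y xV yV; rewrite /edge rxy cxy eqxx => /(_ isT); lia.
have cbV : colbound V d'.+1.
  by move=> a b aV bV ab; have := minx a b aV bV ab; rewrite ed' cxy; lia.
apply: (@exact_mid _ _ _ y); first exact: MonI_vars_up.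
  move=> uy; apply: (@eq_exact _ _ (MonI_vars V t.+1 (Some y))) => [v|].
    by rewrite MonI_vars_colon.
  apply: (@exact_star t d' y) => //; last by move: hi; rewrite (mdegBU uy); lia.
    by move=> W; apply: IHt.
  move=> W i' u' WV cbW hi'; apply: (IHc (d' + #|W|).+1) => //.
  by have := subset_leq_card WV; lia.
apply: (@eq_exact _ _ (MonI_vars (V :\ y) t.+1 None)) => [v|].
  by rewrite MonI_vars_addvar.
apply: (IHc (d + #|V :\ y|).+1) => //; first by move: cV; rewrite (cardsD1 y V) yV add1n addnS.
by apply: colbound_sub cb; apply: subD1set.
Qed.

Lemma exact_MonI t i u :
  (i + 2 * t + n.-1 < mdeg u + 2)%N -> exact K (MonI t) i u.
Proof.
move=> h; apply: (@eq_exact _ _ (MonI_vars setT t None)) => [v|].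
  rewrite /MonI_vars (_ : outside _ v = false) ?orbF //; apply/existsPn => w.
  by rewrite inE.
by apply: (@exact_MonI_vars _ _ n.-1) => // a b _ _ _; rewrite leq_addl.
Qed.

End UpperBound.

(** * The lower bound *)

Section Specialization.
Variables (K : fieldType) (m' n' : nat).
Local Notation m := m'.+2.
Local Notation n := n'.+2.
Local Notation r := n'.+1.
Local Notation N := (m * n)%N.
Local Notation S := {mpoly K[N]}.
Local Notation T := {mpoly K[r]}.
Implicit Types (F : {set 'I_r}) (k l : 'I_r) (A B : {set 'I_N}) (z w : {set 'I_N} -> S)
  (u : 'X_{1..N}) (p : S).

Definition row0 : 'I_m := ord0.
Definition row1 : 'I_m := lift ord0 ord0.

Definition var_up k : 'I_N := var_idx row0 (widen_ord (leqnSn _) k).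
Definition var_down k : 'I_N := var_idx row1 (lift ord0 k).

(** The defaults in [yvar] and [yprev] send the last variable of row 1 and the first of row 2 to
    0. *)
Definition spec_var (v : 'I_N) : T :=
  if row_of v == row0 then yvar K r (col_of v) else if row_of v == row1 then yprev K r (col_of
    v) else 0.

Definition spec p : T := p \mPo [tuple spec_var v | v < N].

HB.instance Definition _ := GRing.RMorphism.copy spec
  (comp_mpoly [tuple spec_var v | v < N]).
HB.instance Definition _ := GRing.Linear.copy spec
  (comp_mpoly [tuple spec_var v | v < N]).

Lemma phiU v : spec 'X_v = spec_var v.
Proof. by rewrite /spec comp_mpolyXU -tnth_nth tnth_mktuple. Qed.

Lemma yvar_ord k : yvar K r k = 'X_k.
Proof. by rewrite /yvar insubT //= => lt; congr 'X_[U_(_)]; apply: val_inj. Qed.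

Lemma spec_var_var_up k : spec_var (var_up k) = 'X_k.
Proof. by rewrite /spec_var row_of_var col_of_var eqxx -yvar_ord. Qed.

Lemma spec_var_var_down k : spec_var (var_down k) = 'X_k.
Proof. by rewrite /spec_var row_of_var col_of_var /= -yvar_ord. Qed.

Lemma spec_var_neq0 v : spec_var v != 0 -> exists k, v = var_up k \/ v = var_down k.
Proof.
rewrite /spec_var; have [e|_] := eqVneq (row_of v) row0.
  case/yvar_neq0 => k ek _.
  by exists k; left; apply: rwcl_inj; rewrite ?row_of_var ?col_of_var //; apply: val_inj.
have [e|_] := eqVneq (row_of v) row1; last by rewrite eqxx.
rewrite /yprev; case ec: (nat_of_ord (col_of v)) => [|c]; first by rewrite eqxx.
case/yvar_neq0 => k ek _.
exists k; right; apply: rwcl_inj; rewrite ?row_of_var ?col_of_var //.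
by apply: val_inj; rewrite [LHS]ec [RHS]lift0 ek.
Qed.

Definition choice_var F k := if k \in F then var_down k else var_up k.
Definition transversal F : {set 'I_N} := [set choice_var F k | k : 'I_r].

Lemma var_upE k : var_up k = k :> nat.
Proof. by rewrite /= mul0n. Qed.

Lemma var_downE k : var_down k = (n + k.+1)%N :> nat.
Proof. by rewrite /= /bump /= mul1n. Qed.

Lemma choice_var_inj F1 F2 k l : choice_var F1 k = choice_var F2 l -> k = l.
Proof.
move/(congr1 val); rewrite /choice_var.
by case: ifP => _; case: ifP => _;
  rewrite ?[val (var_up _)]var_upE ?[val (var_down _)]var_downE => h;
  apply: val_inj => /=; have := ltn_ord k; have := ltn_ord l; lia.
Qed.

Lemma var_up_var_down k l : var_up k != var_down l.
Proof.
by apply/eqP => /(congr1 val); rewrite [LHS]var_upE [RHS]var_downE; have := ltn_ord k; lia.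
Qed.

Lemma mem_transversal F v : (v \in transversal F) = [exists k, v == choice_var F k].
Proof.
apply/imsetP/existsP => [[k _ ->]|[k /eqP ->]]; by exists k.
Qed.

Lemma partner_notin F k : choice_var (~: F) k \notin transversal F.
Proof.
rewrite mem_transversal; apply/existsPn => l; apply/eqP => e; have kl := choice_var_inj e;
  subst l.
move: e; rewrite /choice_var inE; case: (k \in F) => /= e.
  by have := var_up_var_down k k; rewrite e eqxx.
by have := var_up_var_down k k; rewrite -e eqxx.
Qed.

Lemma card_transversal F : #|transversal F| = r.
Proof. by rewrite card_imset ?card_ord // => k l; apply: choice_var_inj. Qed.

Lemma pos_transversal F v : pos (transversal F) v = (\sum_k (choice_var F k < v))%N.
Proof.
by rewrite posE big_imset //= => k l _ _; apply: choice_var_inj.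
Qed.

(** All first-row variables precede all second-row ones, so the positions can be counted separately
    for each index l. *)
Lemma pos_toggle F k : k \notin F ->
  (pos (transversal F) (var_down k) + pos (transversal (k |: F)) (var_up k) = (r - #|F|) + k)%N.
Proof.
move=> kF; rewrite !pos_transversal -big_split /=.
have -> : (r - #|F| + k = \sum_l ((l \notin F) + (l < k)))%N.
  rewrite big_split /=; congr addn.
    have := cardsC F; rewrite card_ord => e.
    rewrite -[X in (X - _)%N]e addKn -sum1_card [LHS]big_mkcond /=.
    by apply: eq_bigr => l _; rewrite inE; case: (l \in F).
  have -> : (\sum_(l < r) (l < k) = \sum_(l < r | l < k) 1)%N.
    by rewrite [RHS]big_mkcond /=; apply: eq_bigr => l _; case: (l < k)%N.
  rewrite -(big_ord_widen r (fun=> 1%N)); last by apply: ltnW.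
  by rewrite sum1_card card_ord.
apply: eq_bigr => l _; rewrite /choice_var !inE.
have := ltn_ord l; have := ltn_ord k => hk hl.
have [->|lk] := eqVneq l k.
  by rewrite (negbTE kF) !var_upE !var_downE /bump /= mul1n mul0n; lia.
by rewrite orFb; case: (l \in F); rewrite ?var_upE ?var_downE /bump /= ?mul1n ?mul0n; lia.
Qed.

(* The sign for which the two transversals inside transversal F :|: transversal (k |: F) cancel
  in spec_top_kdiff. *)
Definition esign F := ((\sum_(k in F) (k + r.+1)) + 'C(#|F|, 2))%N.

Lemma esign_toggle F k : k \notin F -> esign (k |: F) = (esign F + (k + r.+1 + #|F|))%N.
Proof.
by move=> kF; rewrite /esign big_setU1 //= cardsU1 kF /= add1n binS bin1; lia.
Qed.

(** Top-degree part of the map of Koszul complexes induced by [spec]: [var_up k] and [var_down k]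
    share a basis vector, so only transversals survive, and [esign] is the sign that sorts them by
    k. *)
Definition spec_top z : T := \sum_(F : {set 'I_r}) (-1) ^+ esign F * spec (z (transversal F)).

Lemma spec_kdiff w A : spec (kdiff w A) = gdiff spec_var (fun D => spec (w D)) A.
Proof.
rewrite rmorph_sum; apply: eq_bigr => v _.
by rewrite !rmorphM rmorphXn rmorphN rmorph1 /= phiU.
Qed.

Lemma gdiff_transversal (f : {set 'I_N} -> T) F : gdiff spec_var f (transversal F) =
  \sum_k (-1) ^+ pos (transversal F) (choice_var (~: F) k) * 'X_k * f (choice_var (~: F) k |:
    transversal F).
Proof.
pose g v := (-1) ^+ pos (transversal F) v * spec_var v * f (v |: transversal F).
have half_deg k : spec_var (choice_var (~: F) k) = 'X_k.
  by rewrite /choice_var; case: ifP; rewrite ?spec_var_var_up ?spec_var_var_down.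
transitivity (\sum_(v in [set choice_var (~: F) k | k : 'I_r]) g v); last first.
  rewrite big_imset => [|k l _ _ /choice_var_inj //].
  by apply: eq_big => [k|k _]; rewrite ?inE // /g half_deg.
rewrite /gdiff big_mkcond [RHS]big_mkcond /=; apply: eq_bigr => v _.
case: (boolP (v \in [set choice_var (~: F) k | k : 'I_r])) => [/imsetP[k _ ->]|vn].
  by rewrite partner_notin.
case: ifP => // /negP vF; have [->|/spec_var_neq0[k hv]] := eqVneq (spec_var v) 0.
  by rewrite mulr0 mul0r.
case: vF; rewrite mem_transversal; apply/existsP; exists k.
have {vn} : v != choice_var (~: F) k.
  by apply: contraNneq vn => ->; apply/imsetP; exists k.
by rewrite /choice_var inE; case: (k \in F) => /=; case: hv => ->; rewrite ?eqxx.
Qed.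

(** The Koszul complex in r variables has no chains of degree r+1. Concretely, the terms of F and
    [k |: F] cancel, as both come from the same set of r+1 variables. *)
Lemma spec_top_kdiff w : spec_top (kdiff w) = 0.
Proof.
pose f A := spec (w A).
pose G k F := (-1) ^+ esign F * ((-1) ^+ pos (transversal F) (choice_var (~: F) k) * 'X_k *
  f (choice_var (~: F) k |: transversal F)) : T.
have -> : spec_top (kdiff w) = \sum_k \sum_F G k F.
  rewrite exchange_big; apply: eq_bigr => F _ /=.
  by rewrite spec_kdiff gdiff_transversal mulr_sumr.
rewrite big1 // => k _; rewrite (bigID (fun F => k \in F)) /= addrC.
rewrite [X in _ + X](reindex_onto (fun F => k |: F) (fun F => F :\ k)) /=; last first.
  by move=> F kF; rewrite setD1K.
rewrite [X in _ + X](eq_bigl (fun F => k \notin F)) => [|F]; last first.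
  rewrite !inE eqxx /=; apply/eqP/idP => [<-|kF]; first by rewrite !inE eqxx.
  by rewrite setU1K.
rewrite -big_split big1 // => F kF /=.
have e1 : choice_var (~: F) k = var_down k by rewrite /choice_var inE kF.
have e2 : choice_var (~: (k |: F)) k = var_up k by rewrite /choice_var !inE eqxx.
have eD : var_down k |: transversal F = var_up k |: transversal (k |: F).
  have h l : l != k -> choice_var (k |: F) l = choice_var F l.
    by move=> lk; rewrite /choice_var !inE (negbTE lk).
  have tvE F1 : transversal F1 = choice_var F1 k |: [set choice_var F1 l | l in [set~ k]].
    apply/setP => v; rewrite mem_transversal !inE.
    apply/existsP/orP => [[l /eqP ->]|[/eqP ->|/imsetP[l _ ->]]]; [|by exists k|by exists l].
    have [->|lk] := eqVneq l k; first by left.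
    by right; apply/imsetP; exists l; rewrite ?inE.
  have s1 : choice_var F k = var_up k by rewrite /choice_var (negbTE kF).
  have s2 : choice_var (k |: F) k = var_down k by rewrite /choice_var !inE eqxx.
  rewrite (tvE F) (tvE (k |: F)) s1 s2 setUCA; congr (_ |: (_ |: _)).
  by apply: eq_in_imset => l; rewrite !inE => lk; rewrite h.
rewrite /G e1 e2 eD esign_toggle // !mulrA -!exprD -mulrDl -mulrDl.
set X := (_ + _ : T); suff -> : X = 0 by rewrite !mul0r.
rewrite /X -signr_odd -[X in _ + X]signr_odd.
have hF : (#|F| <= r)%N by rewrite -[X in (_ <= X)%N](card_ord r) max_card.
have h := pos_toggle kF.
(* By [pos_toggle], the two sign exponents have difference congruent to 2k + 2r + 1 modulo 2. *)
have -> : odd (esign F + (k + r.+1 + #|F|) + pos (transversal (k |: F)) (var_up k))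
    = ~~ odd (esign F + pos (transversal F) (var_down k)).
  move: (esign F) (pos _ _) (pos _ _) h => a b c h; lia.
by case: (odd _); rewrite /= ?expr0 ?expr1 ?subrr ?addNr.
Qed.

(** Here [ci_pow] is a bound predicate variable: it becomes [half_deg_ideal] for the initial ideal
    and the concrete [ci_pow] for the power of J. *)
Lemma koszul_nonzero_spec_top (I : S -> Prop) (ci_pow : T -> Prop) (j : nat) z :
  (r <= j)%N -> ci_pow 0 -> (forall p q : T, ci_pow p -> ci_pow q -> ci_pow (p + q)) ->
  (forall c (p : T), ci_pow p -> ci_pow (c *: p)) -> (forall p, I p -> ci_pow (spec p)) ->
  kchain r j z -> (forall B, I (kdiff z B)) -> ~ ci_pow (spec_top z) -> koszul_nonzero I r j.
Proof.
move=> rj TI0 TID TIZ ITI zc zcyc nTI; split=> //; exists z; split=> //; split=> //.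
case=> w [_ hw]; apply: nTI.
have -> : spec_top z = \sum_F (-1) ^+ esign F * spec (z (transversal F) - kdiff w (transversal
  F)).
  transitivity (spec_top z - spec_top (kdiff w)); first by rewrite spec_top_kdiff subr0.
  rewrite /spec_top -sumrB; apply: eq_bigr => F _.
  by rewrite rmorphB mulrBr.
apply: (big_ind ci_pow) => // F _.
have -> : (-1) ^+ esign F = ((-1) ^+ esign F)%:MP :> T by rewrite rmorphXn /= rmorphN1.
rewrite mul_mpolyC; apply: TIZ; apply: ITI; apply: hw.
exact: card_transversal.
Qed.

End Specialization.

(** * Explicit cycles that are not boundaries *)

Section LowerBound.
Variables (K : fieldType) (m' n' t : nat).
Local Notation m := m'.+2.
Local Notation n := n'.+2.
Local Notation r := n'.+1.
Local Notation N := (m * n)%N.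
Local Notation S := {mpoly K[N]}.
Local Notation T := {mpoly K[r]}.
Local Notation spec := (@spec K m' n').
Implicit Types (F : {set 'I_r}) (k l : 'I_r) (A B : {set 'I_N}) (a b v : 'I_N)
  (u : 'X_{1..N}) (p : S).

(** The power of J considered here is t+1, while this monomial has half-degree only t. *)
Definition top_mon : 'X_{1..r} := (\sum_(k < r) U_(k) + (U_(ord0) *+ t + U_(ord0) *+ t))%MM.

Lemma half_deg_top_mon : half_deg top_mon = t.
Proof.
rewrite /top_mon half_degD mdegMn mdeg1 mul1n /half_deg big1 // => i _.
by rewrite mnm_sumE (bigD1 i) //= big1 ?mnm1E ?eqxx // => k ki; rewrite mnm1E (negbTE ki).
Qed.

Lemma top_mon_prod : 'X_[top_mon] = (\prod_(k < r) 'X_k) * ('X_ord0 * 'X_ord0) ^+ t :> T.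
Proof. by rewrite /top_mon !mpolyXD mprodXE exprMn !mpolyXn. Qed.

Lemma spec_edge a b : edge a b -> (spec ('X_a * 'X_b) = 0 /\ spec (edge_minor K (a, b)) = 0) \/
  exists k, spec ('X_a * 'X_b) = 'X_k * 'X_k /\ spec (edge_minor K (a, b)) = ci_gen K k.
Proof.
have [[i c] ->] := varP a; have [[j d] ->] := varP b => /=.
rewrite edge_var_idx => /andP[ij /eqP dc];
  rewrite edge_minor_var /xv !(rmorphB, rmorphM) /= !phiU.
have h0 e : j != row1 m' -> spec_var K (var_idx j e) = 0.
  move=> j1; rewrite /spec_var row_of_var (negbTE j1); case: eqP => // j0.
  by move: ij; rewrite j0.
have [j1|/h0 h] := eqVneq j (row1 m'); last by left; rewrite !h !mulr0 subrr.
have i0 : i = row0 m' by apply: val_inj; move: ij; rewrite j1 /=; case: (val i).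
have cr : (c < r)%N by have := ltn_ord d; rewrite dc.
right; exists (Ordinal cr).
rewrite j1 i0 /spec_var !row_of_var !col_of_var !eqxx /= dc /=.
by rewrite /ci_gen -(yvar_ord _ (Ordinal cr)).
Qed.

Lemma rep_span_ci_pow p : rep_span t.+1 xpredT p -> ci_pow t.+1 (spec p).
Proof.
elim=> [|c q q' [u [s [ss es _ ->]]] _ IH]; first by rewrite rmorph0; apply: ci_pow_0.
rewrite linearP; apply: ci_pow_D => //; apply: ci_pow_Z; rewrite /poly_rep rmorphM;
  apply: ci_pow_M.
rewrite -ss; elim: s es {ss} => [|[a b] s IHs]; first by move=> _; exact: ci_pow_all.
case/andP=> /= ab /IHs {}IHs; rewrite big_cons rmorphM /=; have {}ab := spec_edge ab.
case: ab => [[_ ->]|[k [_ ->]]]; last exact: ci_pow_g.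
by rewrite mul0r; apply: ci_pow_0.
Qed.

(** The (t+1)-st power of the ideal of the squares y_k^2. *)
Definition half_deg_ideal (p : T) := forall v : 'X_{1..r}, v \in msupp p ->
  (t.+1 <= half_deg v)%N.

Lemma spec_half_deg_ideal p : (forall u, u \in msupp p -> MonI t.+1 u) -> half_deg_ideal (spec p).
Proof.
have TJ0 s : forall v : 'X_{1..r}, v \in msupp (0 : T) -> (s <= half_deg v)%N by move=> v;
  rewrite msupp0.
move=> hp; rewrite [p]mpolyE linear_sum /= big_seq;
  apply: (big_ind half_deg_ideal) => [|p1 p2 h1 h2|u /hp].
- exact: TJ0.
- by move=> v /msuppD_le; rewrite mem_cat => /orP[/h1|/h2].
case/MonIP => mm [s [ss es ->]]; rewrite linearZ /= => v /msuppZ_le;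
  rewrite /lead_rep mpolyXD rmorphM /=.
case/msuppM_le/allpairsP => [[v1 v2] /= [_ h2 ->]].
suff : (t.+1 <= half_deg v2)%N.
  by move/leq_trans; apply; apply: leq_sum => i _; apply: half_leq; rewrite mnmDE leq_addl.
rewrite -ss; elim: s {ss} es v2 h2 => // [[a b] s] IH /= /andP[ab es] v2;
  have {}ab := spec_edge ab.
rewrite big_cons mpolyXD rmorphM /= [X in spec X * _]mpolyXD.
case: ab => [[-> _]|[k [-> _]]]; first by rewrite mul0r; apply: TJ0.
rewrite -mpolyXD; case/msuppM_le/allpairsP => [[w1 w2] /= [+ /(IH es) h ->]].
rewrite msuppX inE => /eqP ->.
by rewrite addmC half_degD mdeg1 addn1.
Qed.

Lemma var_up_notin_tvT l : var_up m' l \notin transversal m' [set: 'I_r].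
Proof.
rewrite mem_transversal; apply/existsPn => k; rewrite /choice_var inE; exact: var_up_var_down.
Qed.

Lemma spec_top_setT (z : {set 'I_N} -> S) : (forall F, F != setT -> z (transversal m' F) = 0) ->
  spec_top z = (-1) ^+ esign [set: 'I_r] * spec (z (transversal m' setT)).
Proof.
move=> h; rewrite /spec_top (bigD1 setT) //= big1 ?addr0 // => F /h ->.
by rewrite rmorph0 mulr0.
Qed.

Lemma neq_setT_notin F : F != setT -> exists l, l \notin F.
Proof. by rewrite eqEsubset subsetT andTb => /subsetPn[l _ lF]; exists l. Qed.

Definition deg_top := (r + (r + 2 * t))%N.

Definition init_cycle A : S := if A == transversal m' setT
  then (\prod_(k < r) 'X_(var_up m' k)) * ('X_(var_up m' ord0) * 'X_(var_down m' ord0)) ^+ t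
    else 0.

Lemma init_cycle_mon : (\prod_(k < r) 'X_(var_up m' k)) * ('X_(var_up m' ord0) * 'X_(var_down
  m' ord0)) ^+ t =
  'X_[(\sum_(k < r) U_(var_up m' k)) + edge_lead (var_up m' ord0, var_down m' ord0) *+ t] :> S.
Proof. by rewrite mpolyXD mprodXE /edge_lead -mpolyXD mpolyXn. Qed.

Lemma edge_ab k : edge (var_up m' k) (var_down m' k).
Proof. by rewrite edge_var_idx /= /bump. Qed.

Lemma MonI_pow e s : edge e.1 e.2 -> @MonI m n s (edge_lead e *+ s)%MM.
Proof.
move=> he; elim: s => [|s IH]; first by apply/MonIP; exists 0%MM, [::]; rewrite lead_rep0.
by rewrite mulmS addmC /edge_lead addmA; apply: MonI_edge.
Qed.

Definition monomial_in (p : S) := forall u, u \in msupp p -> MonI t.+1 u.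

Lemma monomial_inD p q : monomial_in p -> monomial_in q -> monomial_in (p + q).
Proof. by move=> h1 h2 u /msuppD_le; rewrite mem_cat => /orP[/h1|/h2]. Qed.

Lemma monomial_inM p q : monomial_in q -> monomial_in (p * q).
Proof.
move=> h u /msuppM_le/allpairsP[[u1 u2] /= [_ /h + ->]].
by apply: MonI_up; apply: lem_addl.
Qed.

(** Multiplying by x_{2,k+1} completes the factor x_{1,k} to an edge, beside the t copies of x_{1,1}
    x_{2,2}. *)
Lemma init_cycle_cycle B : monomial_in (kdiff init_cycle B).
Proof.
apply: (big_ind monomial_in) => [u||v vB]; [by rewrite msupp0|exact: monomial_inD|].
rewrite /init_cycle; case: eqP => [e|_]; last by rewrite mulr0 => u; rewrite msupp0.
have : v \in transversal m' setT by rewrite -e !inE eqxx.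
rewrite mem_transversal => /existsP[k /eqP ev]; rewrite {}ev /choice_var inE in e vB *.
rewrite -mulrA; apply: monomial_inM; rewrite init_cycle_mon -mpolyXD => u.
rewrite msuppX inE => /eqP ->.
have -> : (U_(var_down m' k) + (\sum_(k < r) U_(var_up m' k) + edge_lead (var_up m' ord0,
  var_down m' ord0) *+ t))%MM =
  ((\sum_(l < r | l != k) U_(var_up m' l) + edge_lead (var_up m' ord0, var_down m' ord0) *+ t)
    + U_(var_up m' k) + U_(var_down m' k))%MM.
  by rewrite (bigD1 k) //= addmC; congr (_ + _)%MM; rewrite -addmA addmC.
apply: MonI_edge; first exact: edge_ab.
by apply: (MonI_up (lem_addl _ _)); apply: MonI_pow; apply: edge_ab.
Qed.

Lemma sign_top_mon s (p : T) : p = (-1) ^+ s * 'X_[top_mon] -> p != 0 /\ msupp p =i [:: top_mon].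
Proof.
move=> ->; have -> : (-1) ^+ s * 'X_[top_mon] = (-1) ^+ s *: 'X_[top_mon] :> T.
  by rewrite -mul_mpolyC rmorphXn /= rmorphN1.
have nz : (-1) ^+ s != 0 :> K by rewrite signr_eq0.
split; first by rewrite -msupp_eq0 msuppMCX.
by move=> v; rewrite msuppMCX.
Qed.

Lemma koszul_nonzero_ini : koszul_nonzero monomial_in r deg_top.
Proof.
apply: (@koszul_nonzero_spec_top K m' n' monomial_in half_deg_ideal deg_top init_cycle).
- exact: leq_addr.
- by move=> v; rewrite msupp0.
- by move=> p q h1 h2 u /msuppD_le; rewrite mem_cat => /orP[/h1|/h2].
- by move=> c p h u /msuppZ_le/h.
- exact: spec_half_deg_ideal.
- move=> A; rewrite /init_cycle; case: (eqVneq A (transversal m' setT)) => [->|_]; last first.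
    by split=> // _ u; rewrite msupp0.
  rewrite card_transversal eqxx leq_addr; split=> // _; rewrite init_cycle_mon => u.
  rewrite msuppX inE => /eqP ->; rewrite mdegD mdegMn mdegD !mdeg1 mdeg_sum.
  rewrite (eq_bigr (fun=> 1%N)) => [|k _]; last by rewrite mdeg1.
  by rewrite sum1_card card_ord /deg_top addKn.
- exact: init_cycle_cycle.
have [|e] := @sign_top_mon (esign [set: 'I_r]) (spec_top init_cycle).
  rewrite spec_top_setT => [|F /neq_setT_notin[l lF]].
    by rewrite /init_cycle eqxx rmorphM rmorph_prod rmorphXn rmorphM top_mon_prod /= !phiU
      spec_var_var_up spec_var_var_down; congr (_ * (_ * _)); apply: eq_bigr => k _;
        rewrite phiU spec_var_var_up.
  rewrite /init_cycle; case: eqP => // e; have := var_up_notin_tvT l.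
  by rewrite -e mem_transversal => /existsPn/(_ l); rewrite /choice_var (negbTE lF) eqxx.
move=> es /(_ top_mon); rewrite es mem_head => /(_ isT).
by rewrite half_deg_top_mon ltnn.
Qed.

Local Notation x0 c := (xv K (row0 m') (inord c : 'I_n)).
Local Notation x1 c := (xv K (row1 m') (inord c : 'I_n)).

Definition minor12 c d : S := x0 c * x1 d - x0 d * x1 c.

Lemma minor12_adj c : (c.+1 < n)%N -> rep_span 1 xpredT (minor12 c c.+1).
Proof.
move=> cn; rewrite /minor12 -edge_minor_var -[edge_minor _ _]mul1r -mpolyX0 -poly_rep1;
  apply: rep_span_rep => //.
by rewrite /edges all_seq1 edge_var_idx !inordK ?eqxx //; apply: ltnW.
Qed.

(** Induction on d - c through x_{1,c+1} [c,d] = x_{1,c} [c+1,d] + x_{1,d} [c,c+1], where [c,d] is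
    [minor12 c d]. *)
Lemma minor12_J c d : (c < d < n)%N ->
  rep_span 1 xpredT ((\prod_(c.+1 <= e < d) x0 e) * minor12 c d).
Proof.
move=> /andP[cd dn]; have [s] : exists s, d = (c + s.+1)%N by exists (d - c).-1; lia.
elim: s c cd => [|s IH] c cd ed.
  have dS : d = c.+1 by lia.
  by rewrite dS in dn *; rewrite big_geq // mul1r; apply: minor12_adj.
have cd' : (c.+1 < d)%N by lia.
rewrite big_ltn //.
have -> : x0 c.+1 * \prod_(c.+2 <= e < d) x0 e * minor12 c d =
   x0 c * (\prod_(c.+2 <= e < d) x0 e * minor12 c.+1 d)
   + (\prod_(c.+2 <= e < d) x0 e * x0 d) * minor12 c c.+1.
  by rewrite /minor12; ring.
apply: lspanD; rewrite -[1%N]add0n; apply: spnM; try exact: rep_span_all.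
  by apply: IH => //; lia.
by apply: minor12_adj; lia.
Qed.

(** The product of first-row variables carries every 2-minor of rows 1 and 2 into J by [minor12_J];
    the power supplies the other t factors. *)
Definition cycle_factor : S := (\prod_(1 <= e < r) x0 e) * (edge_minor K (var_up m' ord0,
  var_down m' ord0)) ^+ t.

Lemma rep_span_exp e s : edge e.1 e.2 -> rep_span s xpredT ((@edge_minor K m n e) ^+ s).
Proof.
move=> he; elim: s => [|s IH]; first by rewrite expr0; apply: rep_span_all.
rewrite exprS -[s.+1]add1n; apply: spnM => //.
rewrite -[edge_minor _ _]mul1r -mpolyX0 -poly_rep1; apply: rep_span_rep => //.
by rewrite /edges all_seq1.
Qed.

Lemma cycle_factor_minor12 c d : (c < n)%N -> (d < n)%N ->
  rep_span t.+1 xpredT (cycle_factor * minor12 c d).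
Proof.
have H (a b : nat) : (a < b < n)%N -> rep_span t.+1 xpredT (cycle_factor * minor12 a b).
  move=> /andP[ab bn].
  have -> : cycle_factor * minor12 a b = (\prod_(1 <= e < a.+1) x0 e * \prod_(b <= e < r) x0 e) *
     ((edge_minor K (var_up m' ord0,
       var_down m' ord0)) ^+ t * (\prod_(a.+1 <= e < b) x0 e * minor12 a b)).
    rewrite /cycle_factor (@big_cat_nat _ _ _ a.+1) //=; last by lia.
    by rewrite (@big_cat_nat _ _ _ b a.+1 r) //=; ring.
  rewrite -[t.+1]add0n; apply: spnM; first exact: rep_span_all.
  rewrite -[t.+1]addn1; apply: spnM; first exact/rep_span_exp/edge_ab.
  by apply: minor12_J; rewrite ab.
move=> cn dn; have [cd|dc|->] := ltngtP c d.
- by apply: H; rewrite cd.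
- rewrite (_ : minor12 c d = - minor12 d c); last by rewrite /minor12; ring.
  by rewrite mulrN; apply: lspanN; apply: H; rewrite dc.
by rewrite /minor12 subrr mulr0; apply: lspan_nil.
Qed.

Definition second_row : {set 'I_N} := [set var_idx (row1 m') c | c : 'I_n].

Lemma mem_second_row v : (v \in second_row) = (row_of v == row1 m').
Proof.
apply/imsetP/eqP => [[c _ ->]|e]; first by rewrite row_of_var.
by exists (col_of v); rewrite // -[LHS]var_rwcl e.
Qed.

Lemma card_second_row : #|second_row| = n.
Proof.
rewrite card_imset ?card_ord // => c d h.
by have := congr1 (@col_of m n) h; rewrite !col_of_var.
Qed.

Definition above v : S := 'X_(var_idx (row0 m') (col_of v)).

Definition delta A : S := (A == second_row)%:R.

(* Contracting e_{2,1} ... e_{2,n} with the first row gives, up to signs, x_{1,l} on the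
   complement of (2,l); its Koszul differential consists of the 2-minors of rows 1, 2. *)
Definition minor_cycle A : S := cycle_factor * gdiff above delta A.

Lemma minor_cycle_cycle B : rep_span t.+1 xpredT (kdiff minor_cycle B).
Proof.
have -> : kdiff minor_cycle B = cycle_factor * gdiff (fun v => 'X_v) (gdiff above delta) B.
  by rewrite mulr_sumr; apply: eq_bigr => k _; rewrite /minor_cycle; ring.
apply: (@gdiff2_in _ _ (fun p => rep_span t.+1 xpredT (cycle_factor * p))).
- by rewrite mulr0; apply: lspan_nil.
- by move=> p q h1 h2; rewrite mulrDr; apply: lspanD.
move=> k l _ _ _ s; rewrite /delta; case: eqP => [e|_]; last first.
  by rewrite !mulr0; apply: lspan_nil.
have kR : k \in second_row by rewrite -e !inE eqxx.
have lR : l \in second_row by rewrite -e !inE eqxx orbT.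
case/imsetP: kR => c _ ->; case/imsetP: lR => d _ ->.
rewrite /above !col_of_var mulr1.
have -> : cycle_factor * ((-1) ^+ s * ('X_(var_idx (row1 m') c) * 'X_(var_idx (row0 m') d) -
    'X_(var_idx (row1 m') d) * 'X_(var_idx (row0 m') c))) =
  (-1) ^+ s *: (cycle_factor * minor12 d c).
  rewrite -mul_mpolyC rmorphXn /= rmorphN1 /minor12 !inord_val /xv; ring.
by apply: lspanZ; apply: cycle_factor_minor12.
Qed.

(** Only x_{2,1} is missing from this transversal inside the second row, so a single summand is
    left. *)
Lemma minor_cycle_top : exists s,
  minor_cycle (transversal m' setT) = (-1) ^+ s * (cycle_factor * x0 0%N).
Proof.
pose v0 : 'I_N := var_idx (row1 m') ord0.
have v0T : v0 \notin transversal m' setT.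
  rewrite mem_transversal; apply/existsPn => k; rewrite /choice_var inE;
    apply/eqP => /(congr1 (@col_of m n)).
  by rewrite !col_of_var.
have tvR v : v \in transversal m' setT -> v \in second_row.
  by rewrite mem_transversal => /existsP[k /eqP ->];
    rewrite /choice_var inE mem_second_row row_of_var.
exists (pos (transversal m' setT) v0); rewrite /minor_cycle /gdiff (bigD1 v0) //= big1 ?addr0.
  have -> : delta (v0 |: transversal m' setT) = 1.
    rewrite /delta (_ : _ == _) //;
      rewrite eqEcard card_second_row cardsU1 v0T card_transversal leqnn andbT.
    by apply/subsetP => v; rewrite !inE => /orP[/eqP ->|/tvR //];
      rewrite mem_second_row row_of_var.
  rewrite mulr1 /above col_of_var (_ : inord 0 = ord0); first by rewrite /xv; ring.
  by apply: val_inj; rewrite /= inordK.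
move=> v /andP[_ vv0]; rewrite /delta; case: eqP => [e|_]; last by rewrite mulr0.
have : v0 \in second_row by rewrite mem_second_row row_of_var.
by rewrite -e !inE (negbTE v0T) orbF eq_sym (negbTE vv0).
Qed.

Lemma minor_cycle_0 A : ~~ (A \subset second_row) || (#|A| != r) -> minor_cycle A = 0.
Proof.
move=> h; rewrite /minor_cycle gdiff0 ?mulr0 // => k kA; rewrite /delta; case: eqP => // e.
case/orP: h => [/negP[]|/eqP[]]; first by rewrite -e subsetUr.
by have := card_second_row; rewrite -e cardsU1 kA /=; lia.
Qed.

Lemma spec_cycle_factor : spec (cycle_factor * x0 0%N) = 'X_[top_mon].
Proof.
have hx0 e : spec (x0 e) = if (e < n)%N then yvar K r e else spec (x0 e).
  case: ifP => // en; by rewrite /xv phiU /spec_var row_of_var col_of_var eqxx inordK.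
rewrite top_mon_prod /cycle_factor !rmorphM rmorphXn /=.
have -> : spec (edge_minor K (var_up m' ord0, var_down m' ord0)) = 'X_ord0 * 'X_ord0.
  rewrite /edge_minor rmorphB !rmorphM /= !phiU spec_var_var_up spec_var_var_down
    corner_var_idx corner_var_idx.
  by rewrite /spec_var !row_of_var !col_of_var /= mulr0 subr0.
rewrite mulrAC; congr (_ * _); rewrite rmorph_prod mulrC /=.
have -> : \prod_(k < r) 'X_k = \prod_(0 <= e < r) yvar K r e.
  by rewrite big_mkord; apply: eq_bigr => k _; rewrite yvar_ord.
rewrite [RHS]big_ltn // hx0 /=; congr (_ * _).
rewrite big_nat [RHS]big_nat; apply: eq_bigr => e /andP[_ er].
by rewrite hx0 (ltn_trans er).
Qed.

Lemma koszul_nonzero_J : koszul_nonzero (rep_span t.+1 xpredT : S -> Prop) r deg_top.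
Proof.
apply: (@koszul_nonzero_spec_top K m' n' _ (@ci_pow K r t.+1) deg_top minor_cycle).
- exact: leq_addr.
- exact: ci_pow_0.
- exact: ci_pow_D.
- exact: ci_pow_Z.
- exact: rep_span_ci_pow.
- move=> A; rewrite leq_addr andbT; split=> [_|cA]; last by apply: minor_cycle_0; rewrite cA orbT.
  rewrite homog_degE /deg_top addKn (_ : (r + 2 * t = (n' + 2 * t) + 1)%N); last by lia.
  apply: dhomogM; first apply: dhomogM.
  + rewrite /xv mprodXE dhomogX /= mdeg_sum.
    rewrite (eq_bigr (fun=> 1%N)) => [|k _]; last by rewrite mdeg1.
    by rewrite sum_nat_const_nat muln1 subSS subn0.
  + by apply: dhomogMn; apply: dhomog_edge_minor.
  apply: rpred_sum => v _; rewrite /delta.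
  have -> : (-1) ^+ pos A v = ((-1) ^+ pos A v)%:MP :> S by rewrite rmorphXn /= rmorphN1.
  rewrite mul_mpolyC -scalerAl; apply: rpredZ; case: eqP => _; last by rewrite mulr0 rpred0.
  by rewrite mulr1 dhomogX /= mdeg1.
- exact: minor_cycle_cycle.
have [s es] := minor_cycle_top.
have [|nz ms] := @sign_top_mon (esign [set: 'I_r] + s) (spec_top minor_cycle).
  rewrite spec_top_setT => [|F /neq_setT_notin[l lF]].
    rewrite es rmorphM /= spec_cycle_factor mulrA exprD; congr (_ * _ * _).
    by rewrite rmorphXn rmorphN1.
  apply: minor_cycle_0; apply/orP; left; apply/subsetPn; exists (var_up m' l).
    by rewrite mem_transversal; apply/existsP; exists l; rewrite /choice_var (negbTE lF).
  by rewrite mem_second_row row_of_var.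
case/ci_pow_supp => // v; rewrite ms inE => /eqP ->.
by rewrite half_deg_top_mon ltnn.
Qed.

End LowerBound.

(** * Regularity *)

Section InitialIdeal.
Variables (K : fieldType) (m n : nat).
Local Notation N := (m * n)%N.
Local Notation S := {mpoly K[N]}.
Implicit Types (s : seq ('I_N * 'I_N)) (u mm : 'X_{1..N}) (p q : S).

(** Homogeneous components stay in the power; this lets the pure lexicographic order of [init_ideal]
    be compared with the graded one used in [groebner]. *)
Lemma rep_span_pihomog t d p : rep_span t xpredT p -> rep_span t xpredT (pihomog mdeg d p).
Proof.
apply: (@lspan_map _ _ _ (pihomog mdeg d)) => {}p [u [s [ss es _ ->]]].
rewrite /=; have [<-|ne] := eqVneq (mdeg (lead_rep u s)) d.
  by rewrite (pihomog_dE (dhomog_poly_rep K u s)); apply: lspan1; exists u, s.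
by rewrite (pihomog_ne0 ne (dhomog_poly_rep K u s)); apply: lspan_nil.
Qed.

Lemma lex_le_lt u v : mdeg u = mdeg v -> lex_le u v -> (u <= v)%O.
Proof.
move=> d [->|[k [h lt]]]; first exact: lexx.
by apply/ltW/ltmcP => //; exists k.
Qed.

Lemma le_lex_le u v : mdeg u = mdeg v -> (u <= v)%O -> lex_le u v.
Proof.
move=> d; rewrite le_eqVlt => /orP[/eqP ->|]; first by left.
by case/(ltmcP d) => k h lt; right; exists k.
Qed.

Lemma mcoeff_pihomog d p v : (pihomog mdeg d p)@_v = if mdeg v == d then p@_v else 0.
Proof.
have e : p = \sum_(b < (maxn (msize p) (mdeg v).+1)) pihomog mdeg b p.
  by apply: pihomog_partitionE; rewrite leq_maxl.
have cf b : mdeg v != b -> (pihomog mdeg b p)@_v = 0.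
  by move=> h; apply: dhomog_nemf_coeff (pihomogP mdeg b p) _.
case: eqP => [<-|/eqP]; last exact: cf.
have lt : (mdeg v < maxn (msize p) (mdeg v).+1)%N by rewrite leq_maxr.
rewrite [in RHS]e (bigD1 (Ordinal lt)) //= mcoeffD [X in _ + X]raddf_sum /= [X in _ +
  X]big1 ?addr0 // => b bv.
by apply: cf; apply: contraNneq bv => h; apply/eqP/val_inj; exact: esym h.
Qed.

Lemma init_idealP t p : init_ideal (ideal_pow (JKP K m n) t) p <->
  (forall u, u \in msupp p -> MonI t u).
Proof.
split.
  apply: (@ideal_gen_min K N _ (fun p => forall u, u \in msupp p ->
    MonI t u)) => [u|q1 q2 h1 h2 u /msuppD_le|q1 q2 h u|].
  - by rewrite msupp0.
  - by rewrite mem_cat => /orP[/h1|/h2].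
  - case/msuppM_le/allpairsP => [[u1 u2] /= [_ /h + ->]].
    by apply: MonI_up; apply: lem_addl.
  move=> q [f [mm [/rep_span_J sf [[mf lead] ->]]]] u; rewrite msuppX inE => /eqP ->.
  have cf : (pihomog mdeg (mdeg mm) f)@_mm != 0.
    by rewrite mcoeff_pihomog eqxx -mcoeff_msupp.
  have nz : pihomog mdeg (mdeg mm) f != 0.
    by apply: contraNneq cf => ->; rewrite mcoeff0.
  (* Within the component of degree [mdeg mm] the two orders agree, so its graded leading exponent
     is [mm]. *)
  have := groebner (rep_span_pihomog (mdeg mm) sf) nz; congr MonI.
  apply/eqP; rewrite eq_le; apply/andP; split; last first.
    by apply: msupp_le_mlead; rewrite mcoeff_msupp.
  have := mlead_supp nz; move: (mlead _) => v.
  rewrite mcoeff_msupp mcoeff_pihomog; case: (eqVneq (mdeg v)) => [dv|_]; last by rewrite eqxx.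
  by rewrite -mcoeff_msupp => /lead; apply: lex_le_lt.
move=> h; rewrite [p]mpolyE big_seq.
apply: (big_ind (@init_ideal K N _)) => [|*|u up].
- exact: ideal_gen0.
- exact: ideal_genD.
case/MonIP: (h u up) => mm [s [ss es eu]].
rewrite eu /lead_rep mpolyXD -mul_mpolyC mulrA; apply: ideal_genM.
rewrite -[X in mpolyX _ X](add0m); apply: ideal_gen_mem.
have [lr cr] := lead_poly_rep K 0 es.
exists (poly_rep K 0 s), (lead_rep 0 s); split; first by apply/rep_span_J; apply: rep_span_rep.
split=> //; split; first by rewrite mcoeff_msupp cr oner_neq0.
move=> v vs; apply: le_lex_le; last by rewrite -lr msupp_le_mlead.
exact: (dhomogP _ _ _ (dhomog_poly_rep K 0 s)).
Qed.

(** Both the power and its initial ideal have [MonI t] as leading exponents, so [exact_MonI] and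
    [transfer] bound the two regularities at once. *)
Lemma reg_bound (I : S -> Prop) t i j :
  I 0 -> (forall p q, I p -> I q -> I (p + q)) -> (forall p q, I q -> I (p * q)) ->
  (forall p, I p -> p != 0 -> MonI t (mlead p)) ->
  (forall u, MonI t u ->
     exists p, [/\ I p, p \is (mdeg u).-homog, p@_u = 1 & (mlead p <= u)%O]) ->
  (0 < t)%N -> koszul_nonzero I i j -> (j - i <= 2 * (t - 1) + (n - 1))%N.
Proof.
move=> I0 ID IM Ilead Ionto t0 [ij [z [zc [zcyc nb]]]].
rewrite leqNgt; apply/negP => lt; apply: nb.
apply: (@transfer K N I (MonI t)) zcyc => // u du.
apply: exact_MonI; rewrite du -subn1; lia.
Qed.

Lemma reg_bound_J t i j : (0 < t)%N ->
  koszul_nonzero (ideal_pow (JKP K m n) t) i j -> (j - i <= 2 * (t - 1) + (n - 1))%N.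
Proof.
apply: reg_bound.
- exact: ideal_gen0.
- exact: ideal_genD.
- exact: ideal_genM.
- by move=> p /rep_span_J; apply: groebner.
move=> u /MonIP[mm [s [ss es ->]]]; have [lr cr] := lead_poly_rep K mm es.
exists (poly_rep K mm s); split=> //; [|exact: dhomog_poly_rep|by rewrite lr].
by apply/rep_span_J; apply: rep_span_rep.
Qed.

Lemma reg_bound_init t i j : (0 < t)%N ->
  koszul_nonzero (init_ideal (ideal_pow (JKP K m n) t)) i j ->
  (j - i <= 2 * (t - 1) + (n - 1))%N.
Proof.
apply: reg_bound.
- exact: ideal_gen0.
- exact: ideal_genD.
- exact: ideal_genM.
- by move=> p /init_idealP h nz; apply: h; apply: mlead_supp.
move=> u hu; exists 'X_[u]; rewrite mleadXm mcoeffX eqxx dhomogX /=; split=> //.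
by apply/init_idealP => v; rewrite msuppX inE => /eqP ->.
Qed.

Lemma eq_koszul_nonzero (I1 I2 : S -> Prop) i j :
  (forall p, I1 p <-> I2 p) -> koszul_nonzero I1 i j -> koszul_nonzero I2 i j.
Proof.
move=> e [ij [z [zc [zcyc nb]]]]; split=> //; exists z; split=> //; split.
  by move=> B cB i0; apply/e; apply: zcyc.
by case=> w [wc hw]; apply: nb; exists w; split=> // A cA; apply/e; apply: hw.
Qed.

End InitialIdeal.

Theorem theorem3p11 (K : fieldType) (m n t : nat) :
  (2 <= m)%N -> (2 <= n)%N -> (1 <= t)%N ->
  is_reg_quot (ideal_pow (JKP K m n) t) (2 * (t - 1) + (n - 1)) /\
  is_reg_quot (init_ideal (ideal_pow (JKP K m n) t)) (2 * (t - 1) + (n - 1)).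
Proof.
case: m => [|[|m]] // _; case: n => [|[|n]] // _; case: t => [|t] // _.
have deg : (deg_top n t - n.+1 = 2 * (t.+1 - 1) + (n.+2 - 1))%N.
  by rewrite /deg_top; lia.
split; split.
- exists n.+1, (deg_top n t); split=> //.
  apply: eq_koszul_nonzero (koszul_nonzero_J K m n t) => p.
  exact: iff_sym (rep_span_J _ _).
- by move=> i j; apply: reg_bound_J.
- exists n.+1, (deg_top n t); split=> //.
  apply: eq_koszul_nonzero (koszul_nonzero_ini K m n t) => p.
  exact: iff_sym (init_idealP _ _).
- by move=> i j; apply: reg_bound_init.
Qed.
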